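(* For an overcommutative semigroup variety $\mathcal V$, the following are equivalent: (i) $\mathcal V$ is a distributive element of the lattice $\mathbf{OC}$; (ii) $\mathcal V$ is a codistributive element of the lattice $\mathbf{OC}$; (iii) $\mathcal V$ is a standard element of the lattice $\mathbf{OC}$; (iv) $\mathcal V$ is a costandard element of the lattice $\mathbf{OC}$; (v) $\mathcal V$ is a neutral element of the lattice $\mathbf{OC}$; (vi) either $\mathcal V=\mathcal{SEM}$ or $\mathcal V=\bigwedge_{i=1}^k\mathcal S_{\lambda_i}$ for some partitions $\lambda_1,\lambda_2,\dots,\lambda_k\in\Lambda$.
   Context: Varieties. $\mathcal{SEM}$ is the variety of all semigroups. For semigroup varieties, $\mathcal X\vee\mathcal Y$ is the variety generated by $\mathcal X\cup\mathcal Y$ and $\mathcal X\wedge\mathcal Y=\mathcal X\cap\mathcal Y$. A semigroup variety is overcommutative if it contains the variety of all commutative semigroups; $\mathbf{OC}$ is the lattice of all overcommutative varieties. $\operatorname{var}\Sigma$ is the semigroup variety defined by the identity system $\Sigma$. Special elements. An element $x$ of a lattice $L$ is distributive if $x\vee(y\wedge z)=(x\vee y)\wedge(x\vee z)$ for all $y,z\in L$; standard if $(x\vee y)\wedge z=(x\wedge z)\vee(y\wedge z)$ for all $y,z\in L$; neutral if, for all $y,z\in L$, the sublattice generated by $x,y,z$ is distributive. Codistributive and costandard elements are defined dually to distributive and standard ones respectively. Words and partitions. $F$ is the free semigroup over $\{x_1,x_2,\dots\}$. For $u\in F$: $\ell(u)$ is its length, $\ell_i(u)$ is the number of occurrences of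 $x_i$ in $u$, $c(u)$ is the set of letters occurring in $u$. For $2\le m\le n$, $\Lambda_{n,m}$ is the set of all sequences of positive integers $\lambda=(\ell_1,\dots,\ell_m)$ with $\ell_1\ge\cdots\ge\ell_m$ and $\sum\ell_i=n$ (partitions of $n$ into $m$ parts), and $\Lambda=\bigcup_{2\le m\le n}\Lambda_{n,m}$. For $\lambda=(\ell_1,\dots,\ell_m)\in\Lambda_{n,m}$, $W_{n,m,\lambda}$ is the set of words $u$ with $c(u)=\{x_1,\dots,x_m\}$ and $\ell_i(u)=\ell_i$ for $i=1,\dots,m$, and $\mathcal W_{n,m,\lambda}=\operatorname{var}\{u\approx v\mid u,v\in W_{n,m,\lambda}\}$. For $\lambda=(\ell_1,\dots,\ell_m)\in\Lambda_{n,m}$: $q(\lambda)$ is the number of $i$ with $\ell_i=1$; $r(\lambda)$ is the sum of all $\ell_i$ with $\ell_i>1$ (and $0$ if there are none); $s(\lambda)=\max\{r(\lambda)-q(\lambda)-\delta,0\}$ where $\delta=0$ if $\lambda=(2,1)$ and $\delta=1$ otherwise. For $k\ge0$, $\lambda^k\in\Lambda_{n+k,m+k}$ is obtained from $\lambda$ by appending $k$ components equal to $1$. Finally, $\mathcal S_\lambda=\bigwedge_{i=0}^{s(\lambda)}\mathcal W_{n+i,m+i,\lambda^i}$. *)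

(* Defs.v *)
From HB Require Import structures.
From mathcomp Require Import all_boot all_order.
From mathcomp Require Import boolp.

Set Implicit Arguments.
Unset Strict Implicit.
Unset Printing Implicit Defensive.

Import Order.TTheory.
Local Open Scope nat_scope.

Section SpecialElements.
Local Open Scope order_scope.
Context {d : Order.disp_t} {L : latticeType d}.
Implicit Types x y z : L.

Definition distributive_element x : Prop :=
  forall y z, x `|` (y `&` z) = (x `|` y) `&` (x `|` z).

Definition codistributive_element x : Prop :=
  forall y z, x `&` (y `|` z) = (x `&` y) `|` (x `&` z).

Definition standard_element x : Prop :=
  forall y z, (x `|` y) `&` z = (x `&` z) `|` (y `&` z).

Definition costandard_element x : Prop :=
  forall y z, (x `&` y) `|` z = (x `|` z) `&` (y `|` z).

Inductive generated_sublattice (A : L -> Prop) : L -> Prop :=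
| gen_base x : A x -> generated_sublattice A x
| gen_meet x y : generated_sublattice A x -> generated_sublattice A y ->
    generated_sublattice A (x `&` y)
| gen_join x y : generated_sublattice A x -> generated_sublattice A y ->
    generated_sublattice A (x `|` y).

Definition distributive_sublattice (M : L -> Prop) : Prop :=
  forall a b c, M a -> M b -> M c -> a `&` (b `|` c) = (a `&` b) `|` (a `&` c).

Definition neutral_element x : Prop :=
  forall y z,
    distributive_sublattice
      (generated_sublattice (fun t => [\/ t = x, t = y | t = z])).

End SpecialElements.

(* MathComp's semigroupType is not used: classes of semigroups are made below
   into the elements of a latticeType, so the carriers need a universe strictly
   smaller than that of choiceType.  The empty semigroup is allowed; it belongs
   to every variety, so it does not affect the lattice of varieties. *)
Record semigroup := Semigroup {
  carrier :> Type;
  sg_mul : carrier -> carrier -> carrier;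
  sg_mulA : associative sg_mul
}.

(* The elements of the free semigroup F are the nonempty sequences of letters;
   the natural number i stands for the letter x_(i+1). *)
Record word := Word { first_letter : nat; other_letters : seq nat }.

Definition letters (w : word) : seq nat := first_letter w :: other_letters w.

Definition eval (S : semigroup) (f : nat -> S) (w : word) : S :=
  foldl (fun a i => sg_mul a (f i)) (f (first_letter w)) (other_letters w).

Definition satisfies (S : semigroup) (u v : word) : Prop :=
  forall f : nat -> S, eval f u = eval f v.

Definition sg_class := semigroup -> Prop.

Definition var (Sigma : word -> word -> Prop) : sg_class :=
  fun S => forall u v, Sigma u v -> satisfies S u v.

Definition is_variety (K : sg_class) : Prop :=
  exists Sigma, forall S, K S <-> var Sigma S.

Definition generated_variety (K : sg_class) : sg_class :=
  fun S => forall V, is_variety V -> (forall T, K T -> V T) -> V S.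

Definition overcommutative (K : sg_class) : Prop :=
  forall S : semigroup, commutative (@sg_mul S) -> K S.

Lemma generated_varietyP (K : sg_class) : is_variety (generated_variety K).
Proof.
exists (fun u v => forall T, K T -> satisfies T u v) => S; split.
  move=> KS; apply: KS => [|T KT u v uv]; last exact: uv.
  by exists (fun u v => forall T, K T -> satisfies T u v).
move=> SK V [Sigma VE] KV; apply/VE => u v uv.
by apply: SK => T /KV /VE; apply.
Qed.

Lemma var_is_variety Sigma : is_variety (var Sigma).
Proof. by exists Sigma. Qed.

Lemma capv_is_variety (K K' : sg_class) :
  is_variety K -> is_variety K' -> is_variety (fun S => K S /\ K' S).
Proof.
move=> [Sigma KE] [Sigma' KE'].
exists (fun u v => Sigma u v \/ Sigma' u v) => S; split.
  by move=> [/KE KS /KE' KS'] u v [/KS|/KS'].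
move=> H; split; [apply/KE|apply/KE'] => u v uv; apply: H; by [left|right].
Qed.

Lemma sem_is_variety : is_variety (fun=> True).
Proof. by exists (fun _ _ => False) => S; split=> // _ u v []. Qed.

Record OC := MkOC {
  OC_class :> semigroup -> Prop;
  OC_variety : is_variety OC_class;
  OC_overcommutative : overcommutative OC_class
}.

Lemma OC_ext (V W : OC) : (forall S, V S <-> W S) -> V = W.
Proof.
case: V W => [K Kv Ko] [K' Kv' Ko'] /= KK'.
have E : K = K' by apply: funext => S; apply: propext.
by case: _ / E Kv' Ko' {KK'} => Kv' Ko'; congr MkOC; apply: Prop_irrelevance.
Qed.

HB.instance Definition _ := gen_eqMixin OC.
HB.instance Definition _ := gen_choiceMixin OC.

Definition OC_le (V W : OC) : bool := `[< forall S, V S -> W S >].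

Fact OC_meet_overcommutative (V W : OC) : overcommutative (fun S => V S /\ W S).
Proof. by move=> S SC; split; apply: OC_overcommutative. Qed.

Definition OC_meet (V W : OC) : OC :=
  MkOC (capv_is_variety (OC_variety V) (OC_variety W))
       (@OC_meet_overcommutative V W).

Fact OC_join_overcommutative (V W : OC) :
  overcommutative (generated_variety (fun S => V S \/ W S)).
Proof. by move=> S SC U _; apply; left; apply: OC_overcommutative. Qed.

Definition OC_join (V W : OC) : OC :=
  MkOC (generated_varietyP _) (@OC_join_overcommutative V W).

Definition SEM : OC := MkOC sem_is_variety (fun _ _ => I).

Fact OC_display : Order.disp_t. Proof. exact: (Order.Disp tt tt). Qed.

Fact OC_le_refl : reflexive OC_le.
Proof. by move=> V; apply/asboolP. Qed.

Fact OC_le_anti : antisymmetric OC_le.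
Proof.
move=> V W /andP[/asboolP VW /asboolP WV].
by apply: OC_ext => S; split; [apply: VW|apply: WV].
Qed.

Fact OC_le_trans : transitive OC_le.
Proof.
by move=> V U W /asboolP UV /asboolP VW; apply/asboolP => S /UV /VW.
Qed.

HB.instance Definition _ :=
  Order.Le_isPOrder.Build OC_display OC OC_le_refl OC_le_anti OC_le_trans.

Fact OC_meetP (U V W : OC) : (U <= OC_meet V W)%O = (U <= V)%O && (U <= W)%O.
Proof.
apply/asboolP/andP => [H|[/asboolP UV /asboolP UW] S US].
  by split; apply/asboolP => S /H[].
by split; [apply: UV|apply: UW].
Qed.

Fact OC_joinP (U V W : OC) : (OC_join U V <= W)%O = (U <= W)%O && (V <= W)%O.
Proof.
apply/asboolP/andP => [H|[/asboolP UW /asboolP VW] S].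
  by split; apply/asboolP => S KS; apply: H => X _; apply; [left|right].
by apply; [apply: OC_variety|move=> T [/UW|/VW]].
Qed.

HB.instance Definition _ :=
  Order.POrder_MeetJoin_isLattice.Build OC_display OC OC_meetP OC_joinP.

Fact OC_lex1 (V : OC) : (V <= SEM)%O.
Proof. exact/asboolP. Qed.

HB.instance Definition _ := Order.hasTop.Build OC_display OC OC_lex1.

Definition Lambda_nm (n m : nat) : pred (seq nat) :=
  [pred lam : seq nat | [&& 2 <= m <= n, size lam == m, sumn lam == n,
                            all (fun l => 0 < l) lam & sorted geq lam]].

Definition Lambda (lam : seq nat) : Prop := exists n m, Lambda_nm n m lam.

(* W_(n,m,lam), where n = sumn lam and m = size lam are determined by lam. *)
Definition Wwords (lam : seq nat) (u : word) : Prop :=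
  (forall i, (i \in letters u) = (i < size lam)) /\
  (forall i, i < size lam -> count_mem i (letters u) = nth 0 lam i).

Definition Wident (lam : seq nat) (u v : word) : Prop :=
  Wwords lam u /\ Wwords lam v.

Lemma eval_comm (S : semigroup) (f : nat -> S) (u v : word) :
  commutative (@sg_mul S) -> perm_eq (letters u) (letters v) ->
  eval f u = eval f v.
Proof.
move=> SC; pose op (a : option S) (i : nat) : option S :=
  Some (if a is Some a then sg_mul a (f i) else f i).
have opE w : foldl op None (letters w) = Some (eval f w).
  case: w => x s; rewrite /eval /= -[op None x]/(Some (f x)).
  by elim: s (f x) => [|y s IHs] a //=; rewrite -IHs.
have opC a i j : op (op a i) j = op (op a j) i.
  case: a => [a|] /=; last by congr Some; apply: SC.
  by congr Some; rewrite -!sg_mulA (SC (f i)).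
have opP s a i : foldl op (op a i) s = op (foldl op a s) i.
  by elim: s a => //= j s IHs a; rewrite opC IHs.
have H s t a : perm_eq s t -> foldl op a s = foldl op a t.
  elim: s t a => [|x s IHs] t a; first by rewrite perm_sym => /perm_nilP ->.
  move=> st; have xt : x \in t by rewrite -(perm_mem st) mem_head.
  move: st; case/splitPr: xt => t1 t2 st.
  have st' : perm_eq s (t1 ++ t2).
    by rewrite -(perm_cons x) (perm_trans st) // perm_catC /= perm_cons perm_catC.
  by rewrite /= (IHs _ _ st') !foldl_cat /= opP.
by move=> uv; apply: Some_inj; rewrite -!opE; apply: H.
Qed.

Lemma Wwords_perm lam u v :
  Wwords lam u -> Wwords lam v -> perm_eq (letters u) (letters v).
Proof.
move=> [u1 u2] [v1 v2]; rewrite /perm_eq; apply/allP => i _; apply/eqP.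
rewrite -[LHS]/(count_mem i (letters u)) -[RHS]/(count_mem i (letters v)).
have [lti|gei] := ltnP i (size lam); first by rewrite u2 // v2.
have N w : (i \in letters w) = (i < size lam) -> count_mem i (letters w) = 0.
  by move=> wi; apply/count_memPn; rewrite wi ltnNge gei.
by rewrite !N.
Qed.

Lemma Wvar_overcommutative lam : overcommutative (var (Wident lam)).
Proof.
move=> S SC u v [uW vW] f.
by apply: eval_comm => //; apply: Wwords_perm uW vW.
Qed.

Definition Wvar (lam : seq nat) : OC :=
  MkOC (var_is_variety (Wident lam)) (@Wvar_overcommutative lam).

Definition q_ (lam : seq nat) : nat := count_mem 1 lam.

Definition r_ (lam : seq nat) : nat := \sum_(l <- lam | 1 < l) l.

Definition delta_ (lam : seq nat) : nat := if lam == [:: 2; 1] then 0 else 1.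

(* Truncated subtraction on nat renders max(r - q - delta, 0). *)
Definition s_ (lam : seq nat) : nat := r_ lam - q_ lam - delta_ lam.

Definition append_ones (lam : seq nat) (k : nat) : seq nat := lam ++ nseq k 1.

Definition Svar (lam : seq nat) : OC :=
  (\meet_(i < (s_ lam).+1) Wvar (append_ones lam i))%O.

(* Main.v *)
From mathcomp Require Import all_boot all_order all_fingroup.
From mathcomp Require Import boolp zify.
Require Import Defs.

(* The lattice OC is dually isomorphic to the lattice of those fully invariant
   congruences of the free semigroup that relate only permutations of the same
   word, and joins and meets of the latter are computed on each set of all
   permutations of a word.  Call such a congruence R zero-one if on each of these
   sets it is either equality or total.

   A zero-one R is distributive, codistributive and cancellable, hence neutral.
   Conversely, let R be distributive or codistributive and relate s to some other
   word.  Congruences supported on the renamings of permutations of s, longer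
   words and words with fewer letters can be prescribed freely.  If s is not
   linear, its permutations fall into at least three classes up to renaming; if R
   relates u and v and w is a renaming of neither, testing R against the
   congruences generated by (v, w) and (u, w) shows that R relates u and w too,
   so R is total.  If s is linear, R amounts to a subgroup of a symmetric group,
   and distributive or codistributive elements of the subgroup lattice are trivial.

   Finally S_lambda is zero-one: s(lambda) is large enough for the identities of
   W_(lambda^i), i <= s(lambda), to imply those of all W_(lambda^i), and every
   word to which an identity of W_lambda applies is the image, under a map of
   letters, of a word of some W_(lambda^i).  Thus a zero-one R is generated by the
   S_lambda with R total on W_lambda, and by Dickson's lemma finitely many of them
   suffice. *)

Set Implicit Arguments.
Unset Strict Implicit.
Unset Printing Implicit Defensive.

Import Order.TTheory.

(** * Special elements of a lattice *)

Section SpecialElementTheory.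
Local Open Scope order_scope.
Context {d : Order.disp_t} {L : latticeType d}.
Implicit Types x y z t a b c : L.

Lemma standard_distributive x : standard_element x -> distributive_element x.
Proof.
move=> std y z; rewrite std joinKI [y `&` (_ `|` _)]meetC std joinA.
by rewrite meetKU meetC.
Qed.

Lemma costandard_codistributive x :
  costandard_element x -> codistributive_element x.
Proof.
move=> costd y z; rewrite costd meetKU [y `|` (_ `&` _)]joinC costd meetA.
by rewrite joinKI joinC.
Qed.

Lemma neutral_standard x : neutral_element x -> standard_element x.
Proof.
move=> neu y z; rewrite meetC (neu y z z x y) 1?meetC 1?[y `&` z]meetC //.
all: by apply: gen_base; (constructor 1 + constructor 2 + constructor 3).
Qed.

Lemma neutral_costandard x : neutral_element x -> costandard_element x.
Proof.
move=> neu y z.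
have [gx gy gz] : let G := generated_sublattice
    (fun t => [\/ t = x, t = y | t = z]) in [/\ G x, G y & G z].
  by split; apply: gen_base; (constructor 1 + constructor 2 + constructor 3).
rewrite (neu y z (x `|` z) y z) //; last exact: gen_join.
by rewrite joinIK [(_ `|` _) `&` y]meetC (neu y z y x z) // -joinA meetUK meetC.
Qed.

(** When [t] lies below the meet or above the join of [y] and [z], these five elements form the
    sublattice generated by the three: a square with a bottom or a top adjoined. *)
Definition two_generated t y z a : Prop :=
  [\/ a = t, a = y, a = z | a = y `&` z] \/ a = y `|` z.

Lemma two_generated_comparable t y z a b :
  t <= y `&` z \/ y `|` z <= t -> two_generated t y z a ->
  two_generated t y z b ->
  [\/ a <= b, b <= a, a = y /\ b = z | a = z /\ b = y].
Proof.
rewrite /two_generated => tyz.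
have mj : y `&` z <= y `|` z by rewrite leIxl ?leUl.
case: tyz; [rewrite lexI => /andP[ty tz]|rewrite leUx => /andP[yt zt]].
  have tm : t <= y `&` z by rewrite lexI ty.
  have tj : t <= y `|` z by rewrite (le_trans ty) ?leUl.
  by move=> [[]|] -> [[]|] ->;
    rewrite ?lexx ?leIl ?leIr ?leUl ?leUr ?ty ?tz ?tm ?tj ?mj;
    by [constructor 1|constructor 2|constructor 3|constructor 4].
have mt : y `&` z <= t by rewrite leIxl.
have jt : y `|` z <= t by rewrite leUx yt.
by move=> [[]|] -> [[]|] ->;
  rewrite ?lexx ?leIl ?leIr ?leUl ?leUr ?yt ?zt ?mt ?jt ?mj;
  by [constructor 1|constructor 2|constructor 3|constructor 4].
Qed.

Lemma two_generated_meet_join t y z a b :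
  t <= y `&` z \/ y `|` z <= t -> two_generated t y z a ->
  two_generated t y z b ->
  two_generated t y z (a `&` b) /\ two_generated t y z (a `|` b).
Proof.
move=> tyz Ga Gb.
case: (two_generated_comparable tyz Ga Gb) => [ab|ba|[-> ->]|[-> ->]].
- by rewrite (meet_l ab) (join_r ab).
- by rewrite (meet_r ba) (join_l ba).
- by split; [left; constructor 4|right].
- by split; [left; constructor 4; rewrite meetC|right; rewrite joinC].
Qed.

(** Two comparable elements [b] and [c] satisfy the law by monotonicity, and the only possibly
    incomparable pair is [y] and [z], for which the choices of [a] are checked one by one. *)
Lemma two_generated_distributive t y z a b c :
  t <= y `&` z \/ y `|` z <= t -> two_generated t y z a ->
  two_generated t y z b -> two_generated t y z c ->
  a `&` (b `|` c) = (a `&` b) `|` (a `&` c).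
Proof.
move=> tyz Ga Gb Gc.
have yzE : a `&` (y `|` z) = (a `&` y) `|` (a `&` z).
  case: Ga => [[]|] ->.
  - case: tyz; [rewrite lexI|rewrite leUx] => /andP[t1 t2].
      by rewrite (meet_l t1) (meet_l t2) joinxx meet_l // lexUl.
    by rewrite (meet_r t1) (meet_r t2) meet_r // leUx t1.
  - by rewrite meetxx joinKI meetKU.
  - by rewrite meetxx joinKIC meetUKC.
  - have mj : y `&` z <= y `|` z by rewrite leIxl ?leUl.
    by rewrite (meet_l mj) (meet_l (leIl y z)) (meet_l (leIr z y)) joinxx.
  - by rewrite meetxx [_ `&` y]meetC joinKI joinIK.
case: (two_generated_comparable tyz Gb Gc) => [bc|cb|[-> ->]|[-> ->]] //.
- by rewrite (join_r bc) join_r // leI2.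
- by rewrite (join_l cb) join_l // leI2.
- by rewrite joinC yzE joinC.
Qed.

(* The maps a |-> x `|` a and a |-> x `&` a are lattice morphisms which are
   jointly injective, and they send the sublattice generated by x, y, z into
   two-generated lattices with an extra bottom, resp. top. *)
Lemma neutral_elementP x :
  distributive_element x -> codistributive_element x ->
  (forall a b, x `|` a = x `|` b -> x `&` a = x `&` b -> a = b) ->
  neutral_element x.
Proof.
move=> dis codis canc y z a b c Ga Gb Gc.
have joinD u v : x `|` (u `|` v) = (x `|` u) `|` (x `|` v).
  by rewrite joinACA joinxx.
have meetD u v : x `&` (u `&` v) = (x `&` u) `&` (x `&` v).
  by rewrite meetACA meetxx.
have bnd_j : x <= (x `|` y) `&` (x `|` z) \/ (x `|` y) `|` (x `|` z) <= x.
  by left; rewrite lexI !leUl.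
have bnd_m : x <= (x `&` y) `&` (x `&` z) \/ (x `&` y) `|` (x `&` z) <= x.
  by right; rewrite leUx !leIl.
have gen e : generated_sublattice (fun t => [\/ t = x, t = y | t = z]) e ->
    two_generated x (x `|` y) (x `|` z) (x `|` e) /\
    two_generated x (x `&` y) (x `&` z) (x `&` e).
  elim=> {e} [e [] ->|e f _ [ej em] _ [fj fm]|e f _ [ej em] _ [fj fm]].
  - by rewrite joinxx meetxx; split; left; constructor 1.
  - by split; left; constructor 2.
  - by split; left; constructor 3.
  - rewrite dis meetD; split.
      exact: (two_generated_meet_join bnd_j ej fj).1.
    exact: (two_generated_meet_join bnd_m em fm).1.
  - rewrite codis joinD; split.
      exact: (two_generated_meet_join bnd_j ej fj).2.
    exact: (two_generated_meet_join bnd_m em fm).2.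
have {gen} [[aj am] [bj bm] [cj cm]] := And3 (gen _ Ga) (gen _ Gb) (gen _ Gc).
apply: canc.
  by rewrite dis !joinD !dis (two_generated_distributive bnd_j aj).
by rewrite meetD !codis !meetD (two_generated_distributive bnd_m am).
Qed.

End SpecialElementTheory.

(** * Identities of overcommutative varieties *)

(** [None] is a unit adjoined to [S], so that evaluation extends to the empty sequence and turns
    concatenation into multiplication. *)
Definition omul (S : semigroup) (a b : option S) : option S :=
  match a, b with
  | Some x, Some y => Some (sg_mul x y)
  | None, _ => b
  | _, None => a
  end.

Lemma omulA (S : semigroup) : associative (@omul S).
Proof. by case=> [a|] [b|] [c|] //=; rewrite sg_mulA. Qed.

Arguments omul : simpl never.

(* The value is None on the empty word only. *)
Definition evs (S : semigroup) (f : nat -> S) (s : seq nat) : option S :=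
  foldr (fun i => omul (Some (f i))) None s.

Lemma evs_cat (S : semigroup) (f : nat -> S) s t :
  evs f (s ++ t) = omul (evs f s) (evs f t).
Proof. by elim: s => //= i s ->; rewrite omulA. Qed.

Lemma evs_letters (S : semigroup) (f : nat -> S) w :
  evs f (letters w) = Some (eval f w).
Proof.
case: w => i s; rewrite /eval /=.
elim: s (f i) => [|j s IHs] a //=; rewrite -IHs.
by case: (evs f s) => //= b; rewrite /omul sg_mulA.
Qed.

Definition mkword (s : seq nat) : word := Word (head 0 s) (behead s).

Lemma lettersK : cancel letters mkword. Proof. by case. Qed.

Lemma mkwordK s : s != [::] -> letters (mkword s) = s.
Proof. by case: s. Qed.

Lemma evs_mkword (S : semigroup) (f : nat -> S) s :
  s != [::] -> evs f s = Some (eval f (mkword s)).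
Proof. by move=> s0; rewrite -evs_letters mkwordK. Qed.

Definition subst (f : nat -> seq nat) (s : seq nat) : seq nat :=
  flatten (map f s).

Lemma subst_cat f s t : subst f (s ++ t) = subst f s ++ subst f t.
Proof. by rewrite /subst map_cat flatten_cat. Qed.

Lemma subst1 g s : subst (fun i => [:: g i]) s = map g s.
Proof. by elim: s => //= i s <-. Qed.

Lemma evs_subst (S : semigroup) (f : nat -> S) (g : nat -> seq nat) s :
  (forall i, g i != [::]) ->
  evs f (subst g s) = evs (fun i => eval f (mkword (g i))) s.
Proof.
move=> g0; elim: s => //= i s IHs.
by rewrite -[subst _ _]/(g i ++ subst g s) evs_cat IHs -evs_mkword.
Qed.

(** Fully invariant congruences of the free semigroup that relate only words equal in every
    commutative semigroup. The empty sequence is included but is related only to itself, and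
    substitutions send no letter to it. *)
Record balanced_congruence (R : seq nat -> seq nat -> Prop) : Prop := {
  bc_refl s : R s s;
  bc_sym s t : R s t -> R t s;
  bc_trans s t u : R s t -> R t u -> R s u;
  bc_perm s t : R s t -> perm_eq s t;
  bc_ctx a b s t : R s t -> R (a ++ s ++ b) (a ++ t ++ b);
  bc_subst f s t : (forall i, f i != [::]) -> R s t -> R (subst f s) (subst f t)
}.

Lemma bc_cat R s s' t t' : balanced_congruence R ->
  R s s' -> R t t' -> R (s ++ t) (s' ++ t').
Proof.
move=> bR ss' tt'; apply: (bc_trans bR (bc_ctx bR [::] t ss')).
by have := bc_ctx bR s' [::] tt'; rewrite !cats0.
Qed.

Lemma bc_map R g s t : balanced_congruence R -> R s t -> R (map g s) (map g t).
Proof. by move=> bR st; rewrite -!subst1; apply: bc_subst. Qed.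

(** Finite chains of steps in [R] or [R'], extended at their far end; for congruences this is the
    join. *)
Inductive rjoin (R R' : seq nat -> seq nat -> Prop) (s : seq nat) :
  seq nat -> Prop :=
| rjoin_refl : rjoin R R' s s
| rjoin_step t u : rjoin R R' s t -> R t u \/ R' t u -> rjoin R R' s u.

Lemma rjoin_bc R R' : balanced_congruence R -> balanced_congruence R' ->
  balanced_congruence (rjoin R R').
Proof.
move=> bR bR'.
have tr s t u : rjoin R R' s t -> rjoin R R' t u -> rjoin R R' s u.
  by move=> st; elim=> // v w _ IH; apply: rjoin_step.
split=> //.
- by constructor.
- move=> s t; elim=> [|u v _ IH uv]; first by constructor.
  apply: tr IH; apply: (@rjoin_step _ _ _ v); first by constructor.
  by case: uv => /bc_sym; [left|right]; auto.
- move=> s t; elim=> // u v _ IH uv; apply: perm_trans IH _.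
  by case: uv => /bc_perm; apply.
- move=> a b s t; elim=> [|u v _ IH uv]; first by constructor.
  by apply: rjoin_step IH _; case: uv => /bc_ctx; [left|right]; auto.
- move=> f s t f0; elim=> [|u v _ IH uv]; first by constructor.
  by apply: rjoin_step IH _; case: uv => /bc_subst; [left|right]; auto.
Qed.

Lemma capr_bc R R' : balanced_congruence R -> balanced_congruence R' ->
  balanced_congruence (fun s t => R s t /\ R' s t).
Proof.
move=> bR bR'; split.
- by split; apply: bc_refl.
- by move=> s t [/bc_sym H /bc_sym H']; auto.
- by move=> s t u [/bc_trans H /bc_trans H'] [/H K /H' K']; auto.
- by move=> s t [/bc_perm H _]; auto.
- by move=> a b s t [/bc_ctx H /bc_ctx H']; auto.
- by move=> f s t f0 [/bc_subst H /bc_subst H']; auto.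
Qed.

Definition Id (V : sg_class) (s t : seq nat) : Prop :=
  forall S, V S -> forall f : nat -> S, evs f s = evs f t.

Lemma satisfiesP (S : semigroup) u v :
  satisfies S u v <-> forall f : nat -> S, evs f (letters u) = evs f (letters v).
Proof.
split=> uv f; first by rewrite !evs_letters uv.
by have := uv f; rewrite !evs_letters => -[].
Qed.

Definition addn_sg := Semigroup addnA.

Lemma Id_bc (V : OC) : balanced_congruence (Id V).
Proof.
split=> //.
- by move=> s t st S VS f; rewrite st.
- by move=> s t u st tu S VS f; rewrite st ?tu.
- move=> s t st; apply/seq.permP => p.
  (* Sending the letters in [p] to 1 and the others to 0 in the commutative semigroup of natural
     numbers counts occurrences; the default 0 serves the empty word. *)
  have E u : count p u = odflt 0 (@evs addn_sg p u).
    by elim: u => //= i u ->; case: evs => //=; rewrite addn0.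
  by rewrite !E st //; apply: OC_overcommutative => x y /=; apply: addnC.
- by move=> a b s t st S VS f; rewrite !evs_cat st.
- by move=> f s t f0 st S VS g; rewrite !evs_subst // st.
Qed.

Lemma OC_Id (V : OC) S :
  V S <-> forall s t, Id V s t -> forall f : nat -> S, evs f s = evs f t.
Proof.
split=> [VS s t st f|H]; first exact: st.
have [Sigma VE] := OC_variety V; apply/VE => u v uv.
by apply/satisfiesP/H => T /VE /(_ _ _ uv) /satisfiesP.
Qed.

Lemma OC_le_Id (V W : OC) :
  (V <= W)%O <-> forall s t, Id W s t -> Id V s t.
Proof.
split=> [/asboolP VW s t st S /VW VS|H]; first exact: st.
by apply/asboolP => S VS; apply/OC_Id => s t /H; apply.
Qed.

Lemma OC_eq_Id (V W : OC) : (forall s t, Id V s t <-> Id W s t) -> V = W.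
Proof.
by move=> E; apply/eqP; rewrite eq_le; apply/andP; split; apply/OC_le_Id => s t /E.
Qed.

Lemma Id_join (V W : OC) s t :
  Id (V `|` W)%O s t <-> Id V s t /\ Id W s t.
Proof.
split=> [H|[Vst Wst]].
  by split; move: s t H; apply/OC_le_Id; rewrite (leUl, leUr).
case: s Vst Wst => [|i s] Vst Wst.
  by move: (bc_perm (Id_bc V) Vst); rewrite perm_sym => /perm_nilP ->.
case: t Vst Wst => [|j t] Vst Wst.
  by have := perm_size (bc_perm (Id_bc V) Vst).
move=> S VWS; apply/(@satisfiesP S (Word i s) (Word j t)).
(* The variety defined by this single identity contains both [V] and [W], hence also their join. *)
pose Sigma u v := u = Word i s /\ v = Word j t.
apply: (VWS _ (var_is_variety Sigma)) => // T TVW _ _ [-> ->].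
by apply/satisfiesP; case: TVW => [/Vst|/Wst].
Qed.

(** * The overcommutative variety of a balanced congruence *)

Section VarietyOfCongruence.

Variables (R : seq nat -> seq nat -> Prop) (bR : balanced_congruence R).

Lemma var_bc_overcommutative :
  overcommutative (var (fun u v => R (letters u) (letters v))).
Proof. by move=> S SC u v /(bc_perm bR) uv f; apply: eval_comm. Qed.

Definition OC_of : OC := MkOC (var_is_variety _) var_bc_overcommutative.

Lemma bc_repr_ex s : exists t, `[< R s t >].
Proof. by exists s; apply/asboolP/(bc_refl bR). Qed.

(** A normal form in place of a quotient: [xchoose] depends only on the set of words related to [s],
    so related words get equal representatives. *)
Definition bc_repr s : seq nat := xchoose (bc_repr_ex s).

Lemma bc_reprP s : R s (bc_repr s).
Proof. exact/asboolP/(xchooseP (bc_repr_ex s)). Qed.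

Lemma bc_repr_eq s t : R s t -> bc_repr s = bc_repr t.
Proof.
move=> st; apply: eq_xchoose => u; apply/asboolP/asboolP.
  exact: (bc_trans bR (bc_sym bR st)).
exact: (bc_trans bR st).
Qed.

Lemma bc_repr_neq0 s : s != [::] -> bc_repr s != [::].
Proof. by rewrite -!size_eq0 (perm_size (bc_perm bR (bc_reprP s))). Qed.

(** All words are kept as elements and only products are normalised. Evaluating a one-letter word
    therefore normalises nothing, which is why that case is treated separately below. *)
Definition bc_mul (u v : word) : word :=
  mkword (bc_repr (letters u ++ letters v)).

Lemma letters_bc_mul u v :
  letters (bc_mul u v) = bc_repr (letters u ++ letters v).
Proof. by rewrite mkwordK // bc_repr_neq0. Qed.

Lemma bc_mulA : associative bc_mul.
Proof.
move=> u v w; congr mkword; rewrite !letters_bc_mul; apply: bc_repr_eq.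
apply: (@bc_trans _ bR _ (letters u ++ letters v ++ letters w)).
  by apply: (bc_cat bR (bc_refl bR _)); apply/(bc_sym bR)/bc_reprP.
by rewrite catA; apply: (bc_cat bR (bc_reprP _) (bc_refl bR _)).
Qed.

Definition free_sg := Semigroup bc_mulA.

Lemma evs_free_sg (f : nat -> free_sg) i s :
  let t := subst (fun i => letters (f i)) (i :: s) in
  omap letters (evs f (i :: s)) = Some (if s is [::] then t else bc_repr t).
Proof.
elim: s i => [|j s IHs] i; first by rewrite /subst /= cats0.
move: (IHs j) => /=; case: (omul _ _) => //= x [Ex].
rewrite /omul /= letters_bc_mul Ex; congr Some; apply: bc_repr_eq.
apply: (bc_cat bR (bc_refl bR _)).
case: s {IHs Ex} => [|k s]; first exact: bc_refl.
by apply: bc_sym => //; apply: bc_reprP.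
Qed.

Lemma free_sg_OC_of : OC_of free_sg.
Proof.
move=> u v uv; apply/satisfiesP => f.
suff E : omap letters (evs f (letters u)) = omap letters (evs f (letters v)).
  by move: E; rewrite !evs_letters => /Some_inj/(can_inj lettersK) ->.
case: u v uv => i s [j t] uv; have st := perm_size (bc_perm bR uv).
rewrite !evs_free_sg; congr Some.
(* From length two on both values are normal forms of related words; in length one balancedness
   makes the two letters equal. *)
have := bc_repr_eq (bc_subst (f := fun i => letters (f i)) bR (fun=> isT) uv).
case: s t st uv => [|i' s] [|j' t] //= _ /(bc_perm bR) ij _.
by have /perm_small_eq-> : perm_eq [:: j] [:: i] by rewrite perm_sym.
Qed.

Lemma Id_OC_of s t : Id OC_of s t <-> R s t.
Proof.
split=> [st|Rst].
  (* Evaluating every letter at itself sends a word to a word related to it, so words with equal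
     values are related. *)
  pose f i : free_sg := Word i [::].
  have E i u : exists2 x, omap letters (evs f (i :: u)) = Some x & R (i :: u) x.
    rewrite evs_free_sg (subst1 id) map_id; eexists => //.
    by case: u => [|j u]; [apply: bc_refl|apply: bc_reprP].
  have := bc_perm (Id_bc OC_of) st; case: s t st => [|i s] [|j t] st.
  - by move=> _; apply: bc_refl.
  - by move/perm_size.
  - by move/perm_size.
  have [[x Ex sx] [y Ey ty]] := (E i s, E j t).
  move: Ex; rewrite (st _ free_sg_OC_of) Ey => -[yx] _.
  by apply: (bc_trans bR sx); rewrite -yx; apply: bc_sym.
move=> S VS; case: s t Rst => [|i s] [|j t] Rst //.
- by have := perm_size (bc_perm bR Rst).
- by have := perm_size (bc_perm bR Rst).
- by apply/(@satisfiesP S (Word i s) (Word j t))/VS.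
Qed.

End VarietyOfCongruence.

(** The variety belonging to the join of the two congruences lies in [V] and in [W], hence in their
    meet, so it satisfies the identities of the meet. *)
Lemma Id_meet (V W : OC) s t :
  Id (V `&` W)%O s t <-> rjoin (Id V) (Id W) s t.
Proof.
split=> [VWst|].
  have bJ := rjoin_bc (Id_bc V) (Id_bc W).
  apply/(Id_OC_of bJ); move: s t VWst; apply/OC_le_Id.
  rewrite lexI; apply/andP; split; apply/OC_le_Id => s t st; apply/Id_OC_of.
    by apply: rjoin_step (rjoin_refl _ _ _) _; left.
  by apply: rjoin_step (rjoin_refl _ _ _) _; right.
elim=> // u v _ IH uv; apply: (bc_trans (Id_bc _) IH); case: uv.
  by move: u v {IH}; apply/OC_le_Id/leIl.
by move: u v {IH}; apply/OC_le_Id/leIr.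
Qed.

(** * Zero-one congruences give neutral elements *)

Definition zero_one (R : seq nat -> seq nat -> Prop) : Prop :=
  forall s t u, R s t -> s <> t -> perm_eq s u -> R s u.

(** All words of a chain are permutations of one another, so a single nontrivial step in [R] makes
    [R] total on them; a chain without such a step lies in [Q]. *)
Lemma rjoin_zero_one R Q s t : balanced_congruence R -> balanced_congruence Q ->
  zero_one R -> rjoin R Q s t <-> R s t \/ Q s t.
Proof.
move=> bR bQ R01; split; last first.
  by move=> st; apply: rjoin_step (rjoin_refl _ _ _) st.
elim=> [|u v _ IH uv]; first by left; apply: (bc_refl bR).
have su : perm_eq s u by case: IH => /bc_perm; apply.
have sv : perm_eq s v by apply: perm_trans su _; case: uv => /bc_perm; apply.
case: IH => [Rsu|Qsu]; case: uv => [Ruv|Quv].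
- by left; apply: (bc_trans bR Rsu).
- have [E|/eqP s_u] := eqVneq s u; first by right; rewrite E.
  by left; apply: (R01 _ _ _ Rsu s_u sv).
- have [E|/eqP u_v] := eqVneq u v; first by right; rewrite -E.
  left; apply: (bc_trans bR _ Ruv); apply: (bc_sym bR); apply: R01 Ruv u_v _.
  by rewrite perm_sym.
- by right; apply: (bc_trans bQ Qsu).
Qed.

Lemma zero_one_neutral (V : OC) : zero_one (Id V) -> neutral_element V.
Proof.
move=> V01.
have Im W s t : Id (V `&` W)%O s t <-> Id V s t \/ Id W s t.
  by rewrite Id_meet; apply: rjoin_zero_one => //; apply: Id_bc.
apply: neutral_elementP => [Y Z|Y Z|A B EJ EM].
- apply/le_anti/andP; split; first by rewrite lexI !leU2 ?leIl ?leIr.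
  apply/OC_le_Id => s t /Id_join[Vst /Id_meet YZ]; apply/Id_meet.
  have [<-|/eqP s_t] := eqVneq s t; first exact: rjoin_refl.
  (* [Id V] relates [s] to a different word, hence to every permutation of [s], so each step of the
     chain may be intersected with [Id V]. *)
  elim: YZ => [|u v Yu IH uv]; first exact: rjoin_refl.
  have su : perm_eq s u := bc_perm (rjoin_bc (Id_bc Y) (Id_bc Z)) Yu.
  have sv : perm_eq s v.
    by apply: perm_trans su _; case: uv => /bc_perm; apply; apply: Id_bc.
  have Vuv : Id V u v.
    apply: (bc_trans (Id_bc V) (bc_sym (Id_bc V) (V01 _ _ _ Vst s_t su))).
    exact: V01 Vst s_t sv.
  by apply: rjoin_step IH _; case: uv => uv; [left|right]; apply/Id_join.
- apply: OC_eq_Id => s t; rewrite Im !Id_join !Im; tauto.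
- apply: OC_eq_Id => s t.
  have := Im A s t; rewrite EM Im.
  have := Id_join V A s t; rewrite EJ Id_join; tauto.
Qed.

(** * Congruences prescribed on words of a given type *)

(** Distributivity of the variety, read through the order-reversing passage to congruences;
    [meet_distributive] does the same for codistributivity. The converse inclusions hold in every
    lattice. *)
Definition join_distributive R : Prop :=
  forall B C, balanced_congruence B -> balanced_congruence C ->
  forall s t, R s t -> rjoin B C s t ->
  rjoin (fun u v => R u v /\ B u v) (fun u v => R u v /\ C u v) s t.

Definition meet_distributive R : Prop :=
  forall B C, balanced_congruence B -> balanced_congruence C ->
  forall s t, rjoin R B s t -> rjoin R C s t ->
  rjoin R (fun u v => B u v /\ C u v) s t.

Lemma rjoin_iff R R' Q Q' s t : (forall u v, R u v <-> R' u v) ->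
  (forall u v, Q u v <-> Q' u v) -> rjoin R Q s t -> rjoin R' Q' s t.
Proof.
move=> RR' QQ'; elim=> [|u v _ IH uv]; first exact: rjoin_refl.
by apply: rjoin_step IH _; case: uv => [/RR'|/QQ']; [left|right].
Qed.

Lemma distributive_Id (V : OC) :
  distributive_element V -> join_distributive (Id V).
Proof.
move=> dis B C bB bC s t Vst BCst.
suff : Id (V `|` (OC_of bB `&` OC_of bC))%O s t.
  rewrite dis => /Id_meet; apply: rjoin_iff => u v.
    by rewrite Id_join Id_OC_of.
  by rewrite Id_join Id_OC_of.
apply/Id_join; split=> //; apply/Id_meet; move: BCst.
by apply: rjoin_iff => u v; rewrite Id_OC_of.
Qed.

Lemma codistributive_Id (V : OC) :
  codistributive_element V -> meet_distributive (Id V).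
Proof.
move=> codis B C bB bC s t VBst VCst.
suff : Id (V `&` (OC_of bB `|` OC_of bC))%O s t.
  move/Id_meet; apply: rjoin_iff => // u v.
  by rewrite Id_join !Id_OC_of.
rewrite codis; apply/Id_join; split; apply/Id_meet.
  by move: VBst; apply: rjoin_iff => // u v; rewrite Id_OC_of.
by move: VCst; apply: rjoin_iff => // u v; rewrite Id_OC_of.
Qed.

Notation nletters s := (size (undup s)).

Lemma nletters_perm (s t : seq nat) : perm_eq s t -> nletters s = nletters t.
Proof. by move=> /perm_mem st; apply/perm_size/perm_undup. Qed.

Lemma nletters_map (g : nat -> nat) s : nletters (map g s) <= nletters s.
Proof.
rewrite -[leqRHS](size_map g); apply: uniq_leq_size => [|x]; first exact: undup_uniq.
by rewrite mem_undup => /mapP[y ys ->]; rewrite map_f ?mem_undup.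
Qed.

Lemma nletters_map_inj (g : nat -> nat) s :
  nletters s <= nletters (map g s) -> {in s &, injective g}.
Proof.
move=> le_s x y xs ys gxy; apply/eqP; apply: contraLR le_s => xy.
rewrite -ltnNge.
have ys' : y \in rem x (undup s).
  by rewrite mem_rem_uniq ?undup_uniq // !inE eq_sym xy mem_undup.
have xu : x \in undup s by rewrite mem_undup.
rewrite (perm_size (perm_to_rem xu)) /= ltnS.
rewrite -[leqRHS](size_map g); apply: uniq_leq_size => [|z]; first exact: undup_uniq.
rewrite mem_undup => /mapP[u us ->]; have [->|ux] := eqVneq u x.
  by rewrite gxy map_f.
by rewrite map_f // mem_rem_uniq ?undup_uniq // !inE ux mem_undup.
Qed.

Section Extension.

(* A lies on the words with n letters, m of them distinct; every identity
   which can be derived from A and is not a renaming of an element of A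
   concerns longer words, or words with fewer distinct letters. *)
Variables (n m : nat) (A : seq nat -> seq nat -> Prop).
Hypothesis Asym : forall s t, A s t -> A t s.
Hypothesis Atrans : forall s t u, A s t -> A t u -> A s u.
Hypothesis Aperm : forall s t, A s t -> perm_eq s t.
Hypothesis Adom : forall s t, A s t -> size s = n /\ nletters s = m.
Hypothesis Amap : forall (g : nat -> nat) s t,
  {in s &, injective g} -> A s t -> A (map g s) (map g t).

Definition ext (s t : seq nat) : Prop :=
  [\/ s = t, A s t |
      perm_eq s t /\ (n < size s \/ size s = n /\ nletters s < m)].

Lemma ext_perm s t : ext s t -> perm_eq s t.
Proof. by case=> [->|/Aperm|[]]. Qed.

Lemma ext_dom s t : ext s t -> size s = n -> nletters s = m -> s = t \/ A s t.
Proof.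
move=> st En Em; case: st => [->|st|[_ [|[_]]]]; [by left|by right|..].
  by rewrite En ltnn.
by rewrite Em ltnn.
Qed.

(** A nonempty context lengthens a word. A substitution lengthens it or acts as a map of letters,
    and such a map either identifies two letters of the word or is injective on it, where [Amap]
    applies. *)
Lemma ext_bc : balanced_congruence ext.
Proof.
split.
- by constructor 1.
- move=> s t [->|/Asym|[st H]]; [by constructor 1|by constructor 2|].
  constructor 3; rewrite perm_sym; split=> //.
  by rewrite -(perm_size st) -(nletters_perm st).
- move=> s t u [->//|st|[st Hs]] tu.
    case: tu => [<-|tu|[tu Ht]]; first by constructor 2.
      by constructor 2; apply: Atrans tu.
    constructor 3; have := Aperm st => p; split; first exact: perm_trans tu.
    by rewrite (perm_size p) (nletters_perm p).
  by constructor 3; split=> //; apply: perm_trans st (ext_perm tu).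
- exact: ext_perm.
- move=> a b s t st; have p := ext_perm st.
  have pab : perm_eq (a ++ s ++ b) (a ++ t ++ b) by rewrite perm_cat2l perm_cat2r.
  have [ab0|] := posnP (size a + size b).
    by case: a b ab0 {pab} => [|//] [|//] _; rewrite /= !cats0.
  rewrite -(ltn_add2r (size s)) add0n addnC addnCA => lt_s.
  case: st => [->|/Adom[En _]|[_ Hs]]; [by constructor 1|constructor 3..].
    by split=> //; left; rewrite !size_cat -En.
  split=> //; left; rewrite !size_cat; apply: leq_ltn_trans lt_s.
  by case: Hs => [/ltnW|[->]].
- move=> f s t f0 st; have p := ext_perm st.
  have pf : perm_eq (subst f s) (subst f t) by apply/perm_flatten/perm_map.
  have le_size u : size u <= size (subst f u).
    elim: u => //= i u IHu; rewrite /subst /= size_cat.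
    by rewrite -add1n leq_add // lt0n size_eq0.
  have [ns|le_sn] := ltnP n (size (subst f s)); first by constructor 3; auto.
  pose g i := head 0 (f i).
  have fE u : size (subst f u) <= size u -> subst f u = map g u.
    elim: u => //= i u IHu; rewrite /subst /= size_cat => le_u.
    have := f0 i; rewrite -size_eq0 -lt0n.
    have [le_fi _|lt_fi f_gt0] := leqP (size (f i)) 1.
      rewrite -[flatten _]/(subst f u) IHu.
        rewrite /g; case: (f i) (f0 i) le_fi => // x [|y v] //=.
      move: le_u; rewrite -[flatten _]/(subst f u).
      by move: (f0 i); rewrite -size_eq0; case: (f i) le_fi => [|x [|y v]].
    move: (leq_add lt_fi (le_size u)); rewrite add2n => /leq_trans /(_ le_u).
    by rewrite ltnn.
  case: st => [->|As|[_ [lt_s|[En ltm]]]]; first by constructor 1.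
  - have [En Em] := Adom As.
    have Es : subst f s = map g s by apply: fE; rewrite En.
    have Et : subst f t = map g t.
      by apply: fE; rewrite -(perm_size pf) -(perm_size p) En.
    have [lt_m|le_m] := ltnP (nletters (map g s)) m.
      constructor 3; split=> //; right; rewrite Es size_map.
      by split.
    constructor 2; rewrite Es Et; apply: Amap => //.
    by apply: nletters_map_inj; rewrite Em.
  - by move: (leq_trans lt_s (le_size s)); rewrite ltnNge le_sn.
  - have Es : subst f s = map g s by apply: fE; rewrite En.
    constructor 3; split=> //; right; rewrite Es size_map; split=> //.
    exact: leq_ltn_trans (nletters_map g s) ltm.
Qed.

End Extension.

(** * Nonlinear words *)

(** Each letter is replaced by the position of its first occurrence, which gives an invariant of
    words under injective renaming. *)
Definition word_shape (s : seq nat) : seq nat := [seq index x s | x <- s].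

Lemma index_map_in (g : nat -> nat) s x :
  {in s &, injective g} -> x \in s -> index (g x) (map g s) = index x s.
Proof.
elim: s => //= y s IHs gi xs.
have [->|yx] := eqVneq y x; first by rewrite eqxx.
have -> : (g y == g x) = false.
  by apply: contra_neqF yx => /eqP; apply: gi; rewrite ?mem_head.
rewrite IHs //; last by move: xs; rewrite inE eq_sym (negPf yx).
by move=> u v us vs; apply: gi; rewrite inE (us, vs) orbT.
Qed.

Lemma word_shape_map (g : nat -> nat) s :
  {in s &, injective g} -> word_shape (map g s) = word_shape s.
Proof.
by move=> gi; rewrite /word_shape -map_comp; apply/eq_in_map => x xs; apply: index_map_in.
Qed.

Definition map_inv (g : nat -> nat) (s : seq nat) (y : nat) : nat :=
  nth 0 s (index y (map g s)).

Lemma map_invK (g : nat -> nat) (s t : seq nat) :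
  {in s &, injective g} -> {subset t <= s} -> map (map_inv g s) (map g t) = t.
Proof.
move=> gi ts; rewrite -map_comp -[RHS]map_id; apply/eq_in_map => x /ts xs /=.
by rewrite /map_inv index_map_in // nth_index.
Qed.

Lemma bc_map_inj R (g : nat -> nat) s t : balanced_congruence R ->
  {in s &, injective g} -> perm_eq s t -> R (map g s) (map g t) -> R s t.
Proof.
move=> bR gi st /(bc_map (map_inv g s) bR).
by rewrite !map_invK // => x; rewrite (perm_mem st).
Qed.

Lemma in_map_inj_comp (g h : nat -> nat) s : {in s &, injective g} ->
  {in map g s &, injective h} -> {in s &, injective (h \o g)}.
Proof. by move=> gi hi x y xs ys /= /hi E; apply: gi => //; apply: E; apply: map_f. Qed.

Definition renaming_pair (v w s t : seq nat) : Prop :=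
  exists g : nat -> nat, [/\ {in v &, injective g},
    s = map g v \/ s = map g w & t = map g v \/ t = map g w].

Section RenamingPair.

Variables v w : seq nat.
Hypotheses (vw : perm_eq v w) (shape_vw : word_shape v <> word_shape w).

Let inj_perm (g : nat -> nat) : {in v &, injective g} -> {in w &, injective g}.
Proof. by move=> gi x y; rewrite -!(perm_mem vw); apply: gi. Qed.

(** As [v] and [w] have different shapes, the middle word comes from the same one of them under both
    renamings. The renamings then agree on all its letters, which are the letters of [v] and of
    [w]. *)
Lemma renaming_pair_trans s t u : renaming_pair v w s t ->
  renaming_pair v w t u -> renaming_pair v w s u.
Proof.
move=> [g [gi sg tg]] [h [hi th uh]].
have map_eq (a b : seq nat) : perm_eq v a -> perm_eq v b ->
    map g a = map h a -> map g b = map h b.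
  move=> va vb /eq_in_map E; apply/eq_in_map => x.
  by rewrite -(perm_mem vb) (perm_mem va); apply: E.
have gs : word_shape (map g v) <> word_shape (map h w).
  by rewrite !word_shape_map //; apply: inj_perm.
have hs : word_shape (map h v) <> word_shape (map g w).
  by rewrite !word_shape_map //; apply: inj_perm.
have E : map g v = map h v /\ map g w = map h w.
  case: tg th => -> [] E; try by [case: gs; rewrite E | case: hs; rewrite E].
    by split=> //; apply: map_eq E.
  by split=> //; apply: map_eq E; rewrite // perm_sym.
by exists h; rewrite -E.1 -E.2 in uh *; split=> //; rewrite -E.1 -E.2.
Qed.

Lemma renaming_pair_perm s t : renaming_pair v w s t -> perm_eq s t.
Proof.
have wv : perm_eq w v by rewrite perm_sym.
by move=> [g [_ [] -> [] ->]] //; apply: perm_map.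
Qed.

Lemma renaming_pair_dom s t :
  renaming_pair v w s t -> size s = size v /\ nletters s = nletters v.
Proof.
move=> [g [gi sE _]].
have -> : size s = size v by case: sE => ->; rewrite size_map ?(perm_size vw).
split=> //; have -> : nletters s = nletters (map g v).
  by case: sE => -> //; apply/nletters_perm/perm_map; rewrite perm_sym.
apply/eqP; rewrite eqn_leq nletters_map -{1}(map_invK gi (fun=> id)).
exact: nletters_map.
Qed.

Lemma renaming_pair_map (h : nat -> nat) s t : {in s &, injective h} ->
  renaming_pair v w s t -> renaming_pair v w (map h s) (map h t).
Proof.
move=> hi [g [gi sE tE]]; exists (h \o g); split.
- apply: in_map_inj_comp => // x y; case: sE hi => -> hi; first exact: hi.
  by rewrite !(perm_mem (perm_map g vw)); apply: hi.
- by case: sE => ->; rewrite -map_comp; auto.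
- by case: tE => ->; rewrite -map_comp; auto.
Qed.

Definition ext_pair := ext (size v) (nletters v) (renaming_pair v w).

Lemma ext_pair_bc : balanced_congruence ext_pair.
Proof.
apply: ext_bc.
- by move=> s t [g [gi sg tg]]; exists g.
- exact: renaming_pair_trans.
- exact: renaming_pair_perm.
- exact: renaming_pair_dom.
- exact: renaming_pair_map.
Qed.

Lemma ext_pair_vw : ext_pair v w.
Proof. by constructor 2; exists id; rewrite !map_id; split; auto. Qed.

Lemma ext_pair_perm s t : perm_eq v s -> ext_pair s t ->
  s = t \/ renaming_pair v w s t.
Proof.
move=> vs /ext_dom; apply; first by rewrite (perm_size vs).
by rewrite (nletters_perm vs).
Qed.

Lemma renaming_pair_bc R s t : balanced_congruence R ->
  renaming_pair v w s t -> R s t -> s <> t -> R v w.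
Proof.
move=> bR [g [gi sE tE]] Rst s_t; apply: (bc_map_inj bR gi) => //.
by case: sE tE Rst s_t => -> [] -> // Rst _; apply: (bc_sym bR).
Qed.

End RenamingPair.

(* If (v, w) is not in R either, the congruences B and C generated by (v, w)
   and (u, w) meet R, and each other, trivially on the permutations of u, while
   (u, v) is in their join. *)
Lemma third_word R u v w : balanced_congruence R ->
  join_distributive R \/ meet_distributive R ->
  R u v -> u <> v -> perm_eq u w ->
  word_shape u <> word_shape w -> word_shape v <> word_shape w ->
  R u w.
Proof.
move=> bR dis Ruv u_v uw suw svw.
have [//|nRuw] := pselect (R u w); exfalso.
have nRvw : ~ R v w by move=> Rvw; apply: nRuw; apply: (bc_trans bR Ruv).
have uv := bc_perm bR Ruv.
have vw : perm_eq v w by apply: perm_trans uw; rewrite perm_sym.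
have bB := ext_pair_bc vw svw; have bC := ext_pair_bc uw suw.
have Bvw := ext_pair_vw v w; have Cuw := ext_pair_vw u w.
have B1 s t : perm_eq u s -> R s t -> ext_pair v w s t -> s = t.
  move=> us Rst; have vs : perm_eq v s by apply: perm_trans us; rewrite perm_sym.
  move=> /(ext_pair_perm vs)[//|Pst].
  have [//|s_t] := pselect (s = t).
  by case: nRvw; apply: (renaming_pair_bc vw bR Pst).
have C1 s t : perm_eq u s -> R s t -> ext_pair u w s t -> s = t.
  move=> us Rst /(ext_pair_perm us)[//|Pst].
  have [//|s_t] := pselect (s = t).
  by case: nRuw; apply: (renaming_pair_bc uw bR Pst).
case: dis => [/(_ _ _ bB bC _ _ Ruv)|].
  have BCuv : rjoin (ext_pair v w) (ext_pair u w) u v.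
    apply: (@rjoin_step _ _ _ w); last by left; apply: (bc_sym bB).
    by apply: rjoin_step (rjoin_refl _ _ _) _; right.
  move=> /(_ BCuv) H; apply: u_v; elim: H => // s t _ us.
  by rewrite -us => -[[Rut But]|[Rut But]]; [apply: B1|apply: C1].
move=> /(_ _ _ bB bC v w) H; apply: nRvw.
have {}H : rjoin R (fun s t => ext_pair v w s t /\ ext_pair u w s t) v w.
  apply: H; first by apply: rjoin_step (rjoin_refl _ _ _) _; right.
  apply: (@rjoin_step _ _ _ u); last by right.
  by apply: rjoin_step (rjoin_refl _ _ _) _; left; apply: (bc_sym bR).
elim: H => [|s t _ Rvs st]; first exact: (bc_refl bR).
apply: (bc_trans bR Rvs).
case: st => // -[Bst Cst].
have [->|s_t] := pselect (s = t); first exact: (bc_refl bR).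
have vs := bc_perm bR Rvs.
case: (ext_pair_perm vs Bst) => // -[g [gi sg tg]].
case: (ext_pair_perm (perm_trans uv vs) Cst) => // -[h [hi sh th]].
have gs x : x = v \/ x = w -> word_shape (map g x) = word_shape x.
  by case=> ->; rewrite word_shape_map // => y z; rewrite -!(perm_mem vw); apply: gi.
have hs x : x = u \/ x = w -> word_shape (map h x) = word_shape x.
  by case=> ->; rewrite word_shape_map // => y z; rewrite -!(perm_mem uw); apply: hi.
(* Shapes leave only one way for a nontrivial pair to lie in both congruences: [g] of [v], [w] is
   [h] of [u], [w]. Agreement on [w] then makes [g] and [h] equal on all letters and forces
   [u = v]. *)
have bad1 : map g v <> map h w.
  by move/(congr1 word_shape); rewrite gs ?hs; auto.
have bad2 : map g w <> map h u.
  by move/(congr1 word_shape); rewrite gs ?hs; auto => E; case: suw.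
have bad3 : ~ (map g v = map h u /\ map g w = map h w).
  move=> [Ev /eq_in_map Ew]; case: u_v.
  rewrite -(map_invK gi (t := u)); last by move=> x; rewrite (perm_mem uv).
  rewrite (_ : map g u = map h u); last first.
    by apply/eq_in_map => x; rewrite (perm_mem uw); apply: Ew.
  by rewrite -Ev map_invK.
case: sg => Es; case: sh => Es'; case: tg => Et; case: th => Et';
  first [ case: s_t; congruence | case: bad1; congruence
        | case: bad2; congruence | case: bad3; split; congruence ].
Qed.

(** With three shapes available, some permutation always avoids two given ones, so [third_word]
    yields related words [u], [x], [y] of distinct shapes. Any [w] shares its shape with at most one
    of them, and the other two put it in the class. *)
Lemma tripartite_collapse R e1 e2 e3 u v : balanced_congruence R ->
  join_distributive R \/ meet_distributive R ->
  perm_eq u e1 -> perm_eq u e2 -> perm_eq u e3 ->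
  word_shape e1 <> word_shape e2 -> word_shape e1 <> word_shape e3 ->
  word_shape e2 <> word_shape e3 ->
  R u v -> u <> v -> forall w, perm_eq u w -> R u w.
Proof.
move=> bR dis p1 p2 p3 s12 s13 s23 Ruv u_v w uw.
have third x y z : R u x -> R u y -> x <> y -> perm_eq u z ->
    word_shape x <> word_shape z -> word_shape y <> word_shape z -> R u z.
  move=> Rux Ruy x_y uz sxz syz.
  apply: (bc_trans bR Rux); apply: (third_word bR dis _ x_y) => //.
    by apply: (bc_trans bR _ Ruy); apply: bc_sym.
  by apply: perm_trans uz; rewrite perm_sym; apply: (bc_perm bR).
have pick x y : exists z,
    [/\ perm_eq u z, word_shape x <> word_shape z & word_shape y <> word_shape z].
  have [E1|] := pselect (word_shape x = word_shape e1);
  have [F1|] := pselect (word_shape y = word_shape e1);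
  have [E2|] := pselect (word_shape x = word_shape e2);
  have [F2|] := pselect (word_shape y = word_shape e2);
  have [E3|] := pselect (word_shape x = word_shape e3);
  have [F3|] := pselect (word_shape y = word_shape e3);
  try congruence; by [exists e1|exists e2|exists e3].
have [x [ux sux svx]] := pick u v.
have Rux : R u x by apply: (third u v) => //; apply: (bc_refl bR).
have u_x : u <> x by move=> E; apply: sux; rewrite E.
have [y [uy suy sxy]] := pick u x.
have Ruy : R u y by apply: (third u x) => //; apply: (bc_refl bR).
have u_y : u <> y by move=> E; apply: suy; rewrite E.
have x_y : x <> y by move=> E; apply: sxy; rewrite E.
have [E|suw] := pselect (word_shape u = word_shape w).
  by apply: (third x y) => //; congruence.
have [E|sxw] := pselect (word_shape x = word_shape w).
  by apply: (third u y) => //; [apply: (bc_refl bR)|congruence].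
by apply: (third u x) => //; apply: (bc_refl bR).
Qed.

Lemma perm_neq_letter (s t : seq nat) :
  perm_eq s t -> s <> t -> forall a, exists2 b, b \in s & b != a.
Proof.
move=> st s_t a; apply: contrapT => no; apply: s_t.
have sa x : x \in s -> x = a.
  by move=> xs; apply: contrapT => /eqP xa; apply: no; exists x.
have E v : perm_eq s v -> v = nseq (size s) a.
  move=> sv; rewrite (perm_size sv); apply/all_pred1P/allP => x.
  by rewrite -(perm_mem sv) => /sa ->; rewrite /= eqxx.
by rewrite (E t st); apply: E.
Qed.

Lemma nonlinear_collapse R s t u : balanced_congruence R ->
  join_distributive R \/ meet_distributive R -> ~~ uniq s ->
  R s t -> s <> t -> perm_eq s u -> R s u.
Proof.
move=> bR dis nus Rst s_t su.
have [a a2] : exists a, 1 < count_mem a s.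
  apply: contrapT => no; move/negP: nus; apply; apply: count_mem_uniq => x.
  have : count_mem x s <= 1 by rewrite leqNgt; apply/negP => x2; apply: no; exists x.
  have := has_pred1 x s; rewrite has_count.
  by case: (x \in s); case: (count_mem x s) => [|[|k]].
have [b bs ba] := perm_neq_letter (bc_perm bR Rst) s_t a.
(* The permutations beginning with aab, aba and baa have shapes beginning with 002, 010 and 011. *)
have [r sr] : exists r, perm_eq s ([:: a; a; b] ++ r).
  have a_s : a \in s by rewrite -has_pred1 has_count (ltn_trans _ a2).
  have s1 := perm_to_rem a_s; set s' := rem a s in s1.
  have a_s' : a \in s'.
    by rewrite -has_pred1 has_count; move: a2; rewrite (seq.permP s1) /= eqxx.
  have s2 := perm_to_rem a_s'; set s'' := rem a s' in s2.
  have b_s'' : b \in s''.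
    by move: bs; rewrite (perm_mem s1) inE (perm_mem s2) inE (negPf ba).
  exists (rem b s''); apply: (perm_trans s1); rewrite perm_cons.
  by apply: (perm_trans s2); rewrite perm_cons perm_to_rem.
have p2 : perm_eq s ([:: a; b; a] ++ r).
  apply: (perm_trans sr); rewrite perm_cat2r perm_cons.
  exact/permEl/(perm_catC [:: a] [:: b]).
have p3 : perm_eq s ([:: b; a; a] ++ r).
  apply: (perm_trans sr); rewrite perm_cat2r.
  exact/permEl/(perm_catC [:: a; a] [:: b]).
have ab : (a == b) = false by rewrite eq_sym (negPf ba).
apply: (tripartite_collapse bR dis sr p2 p3) Rst s_t _ su;
  by rewrite /word_shape /= !eqxx ?ab ?(negPf ba).
Qed.

(** * Linear words *)

Section SymmetricSubgroups.
Local Open Scope group_scope.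
Variables (T : finType) (H : {group {perm T}}).
Implicit Types i j k : T.

Lemma cycle_tpermP i j (s : {perm T}) :
  s \in <[tperm i j]> -> s = 1 \/ s = tperm i j.
Proof.
case/cycleP=> n ->; elim: n => [|n [] IHn]; first by left.
  by right; rewrite expgS IHn mulg1.
by left; rewrite expgS IHn tperm2.
Qed.

Lemma tperm_eq1 i j : (tperm i j == 1) = (i == j).
Proof.
have [->|/negP ij] := eqVneq i j; first by rewrite tperm1 eqxx.
by apply/eqP => /permP/(_ i); rewrite tpermL perm1 => /eqP; rewrite eq_sym.
Qed.

Lemma meet_cycle_tperm i j :
  tperm i j \notin H -> H :&: <[tperm i j]> = 1.
Proof.
move=> tH; apply/trivgP/subsetP => s; rewrite !inE => /andP[sH].
by case/cycle_tpermP=> sE; [rewrite sE|move: tH; rewrite -sE sH].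
Qed.

(** By the hypothesis one transposition in [H] that moves [j] brings in all others moving [j], and
    these generate the symmetric group. *)
Lemma no_tperm_or_all :
  (forall i j k, i != j -> j != k -> i != k ->
     tperm i j \in H -> tperm j k \in H) ->
  (forall i j, i != j -> tperm i j \notin H) \/ H :=: [set: {perm T}].
Proof.
move=> step; have [no|] := pselect (forall i j, i != j -> tperm i j \notin H).
  by left.
move=> some; right.
have [i [j [ij tH]]] : exists i j, i != j /\ tperm i j \in H.
  apply: contrapT => no; apply: some => i j ij; apply/negP => tH; apply: no.
  by exists i, j.
apply/eqP; rewrite eqEsubset subsetT /= -(gen_tperm j) gen_subG.
apply/subsetP => _ /imsetP[k _ ->].
have [->|jk] := eqVneq j k; first by rewrite tperm1 group1.
have [<-|ik] := eqVneq i k; first by rewrite tpermC.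
exact: step tH.
Qed.

Lemma distributive_perm_group :
  (forall K L : {group {perm T}},
     H :&: (K <*> L) \subset (H :&: K) <*> (H :&: L)) ->
  H :=: 1 \/ H :=: [set: {perm T}].
Proof.
move=> dis; case: no_tperm_or_all => [i j k ij jk ik tij||]; [|move=> no|by right].
  apply: contraT => tjk.
  have tik : tperm i k \notin H.
    apply: contra tjk => tik; have := groupJ tik tij.
    by rewrite tpermJ tpermL tpermD // eq_sym.
  (* Both cycles meet [H] trivially, yet their join contains [tperm i j], the conjugate of one
     generator by the other. *)
  have := dis <[tperm j k]>%G <[tperm i k]>%G.
  rewrite !meet_cycle_tperm // joing1G => /subsetP/(_ (tperm i j)).
  rewrite inE tij /= inE tperm_eq1 (negPf ij) => trivial_meet.
  apply: trivial_meet.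
  rewrite (_ : tperm i j = tperm j k ^ tperm i k); last first.
    by rewrite tpermJ tpermR tpermD 1?[k == j]eq_sym // tpermC.
  by rewrite groupJ // mem_gen // inE cycle_id ?orbT.
left; have [x _|T0] := pickP T; last first.
  by apply/trivgP/subsetP => s _; rewrite inE; apply/eqP/permP => x; have := T0 x.
(* The transpositions moving [x] are adjoined one at a time. By distributivity the meet with [H]
   stays trivial, and in the end the whole symmetric group is reached. *)
pose K ys : {group {perm T}} :=
  foldr (fun y (L : {group {perm T}}) => <[tperm x y]> <*> L)%G 1%G ys.
have HK ys : H :&: K ys = 1.
  elim: ys => [|y ys IHys]; first exact/setIidPr/sub1G.
  apply/trivgP; apply: (subset_trans (dis <[tperm x y]>%G (K ys))).
  rewrite IHys joingG1 /=.
  have [->|xy] := eqVneq x y; first by rewrite tperm1 cycle1 subsetIr.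
  by rewrite meet_cycle_tperm ?no.
rewrite -(HK (enum T)) (_ : K (enum T) = [set: {perm T}] :> {set _}) ?setIT //.
apply/eqP; rewrite eqEsubset subsetT /= -(gen_tperm x) gen_subG.
apply/subsetP => _ /imsetP[y _ ->]; have : y \in enum T by rewrite mem_enum.
elim: (enum T) => //= z ys IHys; rewrite inE => /orP[/eqP->|/IHys yK].
  by rewrite mem_gen // inE cycle_id.
by rewrite mem_gen // inE yK orbT.
Qed.

Lemma codistributive_perm_group :
  (forall K L : {group {perm T}},
     (H <*> K) :&: (H <*> L) \subset H <*> (K :&: L)) ->
  H :=: 1 \/ H :=: [set: {perm T}].
Proof.
move=> dis.
(* A transposition and its conjugate by [h] generate the same group together with [H]. If they
   differ, their cycles meet trivially and codistributivity puts the transposition into [H]. *)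
have fixed h i j : h \in H -> tperm i j \notin H ->
    tperm (h i) (h j) = tperm i j.
  move=> hH tH; apply/eqP; apply: contraNT tH => neq.
  have KL : <[tperm i j]> :&: <[tperm i j ^ h]> = 1.
    apply/trivgP/subsetP => s; rewrite tpermJ !inE.
    case/andP=> /cycle_tpermP[->|->]; first by rewrite eqxx.
    case/cycle_tpermP => [->|E]; first by rewrite eqxx.
    by rewrite -E eqxx in neq.
  have /subsetP/(_ (tperm i j)) := dis <[tperm i j]>%G <[tperm i j ^ h]>%G.
  rewrite KL joingG1; apply; rewrite inE; apply/andP; split.
    by rewrite mem_gen // inE cycle_id orbT.
  rewrite -{1}(conjgK h (tperm i j)) groupJ ?groupV //.
    by rewrite mem_gen // inE cycle_id orbT.
  by rewrite mem_gen // inE hH.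
case: no_tperm_or_all => [i j k ij jk ik tij||]; [|move=> no|by right].
  apply: contraT => tjk.
  have := fixed _ _ _ tij tjk; rewrite tpermR tpermD // => /permP/(_ i).
  rewrite tpermL tpermD 1?eq_sym // => /eqP.
  by rewrite eq_sym (negPf ik).
left; apply/trivgP/subsetP => h hH; rewrite inE; apply: contraT => h1.
have [a ha] : exists a, h a != a.
  apply: contrapT => nofix; case/negP: h1; apply/eqP/permP => a; rewrite perm1.
  by apply: contrapT => /eqP ha; apply: nofix; exists a.
(* [h] preserves every pair of points, so a moved point [a] leaves room for no point besides [a] and
   [h a]; then [h] is itself a transposition. *)
have only c : c != a -> c = h a.
  move=> ca; apply: contrapT => /eqP cha.
  have ac : a != c by rewrite eq_sym.
  have /permP/(_ (h a)) := fixed _ _ _ hH (no _ _ ac).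
  rewrite tpermL tpermD // 1?eq_sym // => /perm_inj E.
  by rewrite E eqxx in ca.
have /negP[] := no _ _ ha; rewrite (_ : tperm _ _ = h) //.
apply/permP => c; have [->|ca] := eqVneq c a; first by rewrite tpermR.
rewrite [c]only // tpermL; apply: contrapT => /eqP; rewrite eq_sym => /only/perm_inj E.
by rewrite E eqxx in ha.
Qed.

End SymmetricSubgroups.

Section LinearWords.

Variable n : nat.
Implicit Types (s t k : 'S_n) (K L : {group 'S_n}).

Definition letter_perm s (i : nat) : nat :=
  if insub i is Some j then val (s j) else i.

Lemma letter_permE s (i : 'I_n) : letter_perm s i = s i.
Proof. by rewrite /letter_perm valK. Qed.

Lemma letter_permM s t i :
  letter_perm (s * t)%g i = letter_perm t (letter_perm s i).
Proof.
have [lt_in|le_ni] := ltnP i n.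
  by rewrite -[i]/(val (Ordinal lt_in)) !letter_permE permM.
by rewrite /letter_perm !insubN -?leqNgt.
Qed.

Lemma letter_perm1 i : letter_perm 1%g i = i.
Proof. by rewrite /letter_perm; case: insubP => // j _ <-; rewrite perm1. Qed.

Lemma letter_permK s : cancel (letter_perm s) (letter_perm s^-1%g).
Proof. by move=> i; rewrite -letter_permM mulgV letter_perm1. Qed.

Definition linear_word s : seq nat := map (letter_perm s) (iota 0 n).

Lemma linear_word1 : linear_word 1%g = iota 0 n.
Proof. by rewrite -[RHS]map_id; apply/eq_map/letter_perm1. Qed.

Lemma map_linear_word s t :
  map (letter_perm t) (linear_word s) = linear_word (s * t)%g.
Proof. by rewrite -map_comp; apply: eq_map => i /=; rewrite letter_permM. Qed.

Lemma linear_word_inj s t : linear_word s = linear_word t -> s = t.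
Proof.
move=> /eq_in_map E; apply/permP => i; apply: val_inj.
by rewrite /= -!letter_permE E // mem_iota /= add0n.
Qed.

Lemma linear_wordP w : perm_eq (iota 0 n) w -> exists s, w = linear_word s.
Proof.
move=> pw; have sw : size w = n by rewrite -(perm_size pw) size_iota.
have uw : uniq w by rewrite -(perm_uniq pw) iota_uniq.
have lt_w (i : 'I_n) : nth 0 w i < n.
  have /(mem_nth 0) : i < size w by rewrite sw.
  by rewrite -(perm_mem pw) mem_iota add0n.
pose f i := Ordinal (lt_w i).
have f_inj : injective f.
  move=> i j [] /eqP; rewrite nth_uniq ?sw // => /eqP; exact: val_inj.
exists (perm f_inj); apply: (@eq_from_nth _ 0); first by rewrite size_map size_iota.
move=> i; rewrite sw => lt_in; rewrite (nth_map 0) ?size_iota // nth_iota //.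
by rewrite add0n -[i in RHS]/(val (Ordinal lt_in)) letter_permE permE.
Qed.

Lemma perm_linear_word s : perm_eq (iota 0 n) (linear_word s).
Proof.
rewrite uniq_perm ?iota_uniq //.
  by rewrite map_inj_uniq ?iota_uniq //; apply: can_inj (letter_permK s).
move=> i; rewrite mem_iota add0n /=; apply/idP/mapP => [lt_in|[j]].
  exists (letter_perm s^-1%g i); last by rewrite -letter_permM mulVg letter_perm1.
  by rewrite mem_iota -[i]/(val (Ordinal lt_in)) letter_permE /=.
by rewrite mem_iota /= add0n => lt_jn ->; rewrite -[j]/(val (Ordinal lt_jn)) letter_permE.
Qed.

Section Stabilizer.

Variables (R : seq nat -> seq nat -> Prop) (bR : balanced_congruence R).

Definition perm_set : {set 'S_n} := [set s | `[< R (iota 0 n) (linear_word s) >]].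

Lemma perm_set_group : group_set perm_set.
Proof.
apply/group_setP; split=> [|s t]; rewrite !inE.
  by apply/asboolP; rewrite linear_word1; apply: (bc_refl bR).
move=> /asboolP Rs /asboolP Rt; apply/asboolP; apply: (bc_trans bR Rt).
by rewrite -[linear_word (s * t)%g]map_linear_word; apply: bc_map.
Qed.

Canonical perm_group := Group perm_set_group.

(** Renaming letters multiplies the permutation on the right, so on linear words [R] is the coset
    relation of [perm_set]. *)
Lemma mem_perm_group s t :
  R (linear_word s) (linear_word t) <-> (t * s^-1)%g \in perm_set.
Proof.
rewrite inE; split=> [|/asboolP]; [move=> st; apply/asboolP|] => [|st].
  have := bc_map (letter_perm s^-1%g) bR st.
  by rewrite !map_linear_word mulgV linear_word1.
have := bc_map (letter_perm s) bR st.
by rewrite -linear_word1 !map_linear_word mul1g mulgKV.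
Qed.

End Stabilizer.

(** The coset relation of [K] carried to all linear words of length [n]; through [ext] it realises
    every subgroup by a congruence. *)
Definition group_rel K (u v : seq nat) : Prop :=
  exists (g : nat -> nat) (s : 'S_n), [/\ s \in K, {in iota 0 n &, injective g},
    u = map g (iota 0 n) & v = map g (linear_word s)].

Definition ext_group K := ext n n (group_rel K).

Lemma inj_comp_letter_perm (g : nat -> nat) s : {in iota 0 n &, injective g} ->
  {in iota 0 n &, injective (g \o letter_perm s)}.
Proof.
move=> gi; apply: in_map_inj_comp => [x y _ _|].
  exact: can_inj (letter_permK s) _ _.
by move=> x y; rewrite -!(perm_mem (perm_linear_word s)); apply: gi.
Qed.

Lemma ext_group_bc K : balanced_congruence (ext_group K).
Proof.
apply: ext_bc.
- move=> _ _ [g [s [sK gi -> ->]]].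
  exists (g \o letter_perm s), s^-1%g; split; first by rewrite groupV.
  + exact: inj_comp_letter_perm.
  + by rewrite map_comp.
  + by rewrite map_comp map_linear_word mulVg linear_word1.
- move=> _ _ _ [g [s [sK gi -> ->]]] [h [t [tK hi E ->]]].
  exists g, (t * s)%g; split=> //; first exact: groupM.
  have {}E : {in iota 0 n, g \o letter_perm s =1 h}.
    by apply/eq_in_map; rewrite map_comp.
  rewrite -map_linear_word -map_comp; apply/esym/eq_in_map => i.
  by rewrite -(perm_mem (perm_linear_word t)) => /E.
- by move=> _ _ [g [s [_ _ -> ->]]]; apply/perm_map/perm_linear_word.
- move=> _ v [g [s [_ gi -> _]]]; rewrite size_map size_iota; split=> //.
  by rewrite undup_id ?size_map ?size_iota // map_inj_in_uniq ?iota_uniq.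
- move=> h u v hi [g [s [sK gi E ->]]]; exists (h \o g), s.
  rewrite E map_comp; split=> //.
    by apply: in_map_inj_comp; rewrite -?E.
  by rewrite map_comp.
Qed.

Lemma perm_set_ext_group K : perm_set (ext_group K) = K.
Proof.
apply/setP => s; rewrite inE; apply/asboolP/idP => [|sK]; last first.
  constructor 2; exists id, s; rewrite !map_id; split=> //.
move/ext_dom; rewrite undup_id ?iota_uniq // size_iota => /(_ erefl erefl)[].
  by rewrite -linear_word1 => /linear_word_inj <-; apply: group1.
move=> [g [t [tK gi Eg Es]]].
suff -> : s = t by [].
apply: linear_word_inj; rewrite Es -[RHS]map_id; apply/eq_in_map => i.
rewrite -(perm_mem (perm_linear_word t)); move: i.
by apply/eq_in_map; rewrite -Eg map_id.
Qed.

(** Each step of a chain of linear words multiplies the permutation by an element of one of the two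
    groups. *)
Lemma perm_set_rjoin R Q (bR : balanced_congruence R) (bQ : balanced_congruence Q) :
  perm_set (rjoin R Q) = (perm_group bR <*> perm_group bQ)%G.
Proof.
have bJ := rjoin_bc bR bQ.
apply/eqP; rewrite eqEsubset; apply/andP; split; last first.
  rewrite -[perm_set _]/(gval (perm_group bJ)) join_subG; apply/andP; split;
    apply/subsetP => s; rewrite !inE => /asboolP Rs; apply/asboolP;
    apply: rjoin_step (rjoin_refl _ _ _) _; auto.
suff JS w : rjoin R Q (iota 0 n) w -> forall s, w = linear_word s ->
    s \in (perm_group bR <*> perm_group bQ)%g.
  by apply/subsetP => s; rewrite inE => /asboolP /JS; apply.
elim=> [s|u v Ju IH uv s] Es.
  by rewrite (_ : s = 1%g) ?group1 //; apply: linear_word_inj; rewrite linear_word1.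
have [t Et] := linear_wordP (bc_perm bJ Ju).
rewrite -(mulgKV t s) groupM ?(IH t) //.
by case: uv; rewrite Et Es => /mem_perm_group H; rewrite mem_gen // inE H ?orbT.
Qed.

Lemma perm_set_capr R Q :
  perm_set (fun u v => R u v /\ Q u v) = perm_set R :&: perm_set Q.
Proof.
apply/setP => s; rewrite !inE.
apply/asboolP/andP => [[Rs Qs]|[/asboolP Rs /asboolP Qs]] //.
by split; apply/asboolP.
Qed.

(** Testing [R] against the congruences [ext_group K] transfers its distributivity to its group
    inside the subgroup lattice. *)
Lemma perm_set_trivial R : balanced_congruence R ->
  join_distributive R \/ meet_distributive R ->
  perm_set R = 1%g \/ perm_set R = [set: 'S_n].
Proof.
move=> bR dis; rewrite -[perm_set R]/(gval (perm_group bR)).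
have EK K : perm_group (ext_group_bc K) = K.
  by apply: val_inj; rewrite /= perm_set_ext_group.
case: dis => dis.
  apply: distributive_perm_group => K L.
  have bRK := capr_bc bR (ext_group_bc K); have bRL := capr_bc bR (ext_group_bc L).
  have := perm_set_rjoin bRK bRL.
  have := perm_set_rjoin (ext_group_bc K) (ext_group_bc L).
  rewrite !EK /= !perm_set_capr !perm_set_ext_group => <- <-.
  apply/subsetP => s; rewrite !inE => /andP[/asboolP Rs /asboolP Js].
  by apply/asboolP; apply: dis => //; apply: ext_group_bc.
apply: codistributive_perm_group => K L.
have bKL := capr_bc (ext_group_bc K) (ext_group_bc L).
have := perm_set_rjoin bR bKL; have := perm_set_rjoin bR (ext_group_bc K).
have := perm_set_rjoin bR (ext_group_bc L).
rewrite !EK /= !perm_set_capr !perm_set_ext_group => <- <- <-.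
apply/subsetP => s; rewrite !inE => /andP[/asboolP Rs /asboolP Js].
by apply/asboolP; apply: dis => //; apply: ext_group_bc.
Qed.

End LinearWords.

Lemma linear_collapse R s t u : balanced_congruence R ->
  join_distributive R \/ meet_distributive R -> uniq s ->
  R s t -> s <> t -> perm_eq s u -> R s u.
Proof.
move=> bR dis us Rst s_t su; set n := size s.
pose g := nth 0 s; pose g' x := index x s.
have sE : s = map g (iota 0 n) by rewrite map_nth_iota0 // take_size.
have gK v : perm_eq s v -> map g (map g' v) = v.
  move=> sv; rewrite -map_comp -[RHS]map_id; apply/eq_in_map => x xv /=.
  by rewrite /g nth_index // (perm_mem sv).
have g's : map g' s = iota 0 n.
  rewrite sE -map_comp -[RHS]map_id; apply/eq_in_map => i.
  by rewrite mem_iota => /andP[_ lt_in] /=; rewrite /g' /g index_uniq.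
have lin v : perm_eq s v -> exists p : 'S_n, map g' v = linear_word p.
  by move=> sv; apply: linear_wordP; rewrite -g's perm_map.
have [p Ep] := lin _ (bc_perm bR Rst); have [q Eq] := lin _ su.
have Hp : p \in perm_set n R.
  by rewrite inE; apply/asboolP; rewrite -Ep -g's; apply: bc_map.
have [E|E] := perm_set_trivial n bR dis.
  case: s_t; move: Hp; rewrite E inE => /eqP p1.
  by rewrite -[RHS]gK ?(bc_perm bR Rst) // Ep p1 linear_word1.
have : q \in perm_set n R by rewrite E inE.
rewrite inE => /asboolP /(bc_map g bR).
by rewrite -sE -Eq gK.
Qed.

Lemma distributive_zero_one R : balanced_congruence R ->
  join_distributive R \/ meet_distributive R -> zero_one R.
Proof.
move=> bR dis s t u Rst s_t su; have [us|us] := boolP (uniq s).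
  exact: linear_collapse dis us Rst s_t su.
exact: nonlinear_collapse dis us Rst s_t su.
Qed.

(** * The identities of S_lambda *)

Lemma perm_map_lift (g : nat -> nat) (c q : seq nat) :
  perm_eq (map g c) q -> exists2 c', perm_eq c c' & q = map g c'.
Proof.
rewrite perm_sym => /(perm_iotaP 0)[Is pIs qE].
exists (map (nth 0 c) Is).
  rewrite perm_sym; apply: (perm_trans (perm_map _ pIs)).
  by rewrite size_map map_nth_iota0 // take_size.
rewrite qE -map_comp; apply/eq_in_map => i.
by rewrite (perm_mem pIs) mem_iota size_map add0n => i_lt; rewrite /= (nth_map 0).
Qed.

Lemma count_mem_leP (s t : seq nat) :
  (forall x, count_mem x s <= count_mem x t) <-> exists r, perm_eq t (s ++ r).
Proof.
split=> [/count_subseqP[s' s't ss']|[r tr] x]; last first.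
  by rewrite (seq.permP tr) count_cat leq_addr.
have [r tr] := perm_to_subseq s't; exists r; apply: (perm_trans tr).
by rewrite perm_cat2r perm_sym.
Qed.

(** * Words on whose permutations a congruence is total *)

Definition collapsed (R : seq nat -> seq nat -> Prop) (p : seq nat) : Prop :=
  forall q, perm_eq p q -> R p q.

Section Collapsed.

Variables (R : seq nat -> seq nat -> Prop) (bR : balanced_congruence R).

Lemma collapsed_eq p q r : collapsed R p -> perm_eq p q -> perm_eq p r -> R q r.
Proof. by move=> cp pq pr; apply: (bc_trans bR _ (cp _ pr)); apply/(bc_sym bR)/cp. Qed.

Lemma collapsed_perm p q : collapsed R p -> perm_eq p q -> collapsed R q.
Proof. by move=> cp pq r qr; apply: (collapsed_eq cp) => //; apply: perm_trans qr. Qed.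

Lemma collapsed_map (g : nat -> nat) p : collapsed R p -> collapsed R (map g p).
Proof. by move=> cp _ /perm_map_lift[q pq ->]; apply/(bc_map g bR)/cp. Qed.

Section AddLinearLetter.

Variable p : seq nat.

Let lin : pred nat := fun x => count_mem x p == 1.

Hypothesis collapsed_rem : forall x, lin x -> collapsed R (rem x p).
Hypothesis lin_gt2 : 2 < count lin p.
Hypothesis lin_half : size p <= (count lin p).*2.

Let lin_mem x : lin x -> x \in p.
Proof. by move=> /eqP x1; rewrite -has_pred1 has_count x1. Qed.

Let third x y : exists z, [/\ lin z, z != x & z != y].
Proof.
have : uniq (filter lin p).
  apply: count_mem_uniq => z; rewrite mem_filter count_filter.
  have [zl|zl] := boolP (lin z); last first.
    apply/eqP; rewrite -leqn0 -(count_pred0 p); apply/eq_leq/eq_count => u /=.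
    by apply/negP => /andP[/eqP ->]; apply/negP.
  rewrite (eq_count (a2 := pred1 z)) => [|u /=]; last first.
    by case: eqVneq => // ->; rewrite zl.
  by rewrite (eqP zl) lin_mem.
move=> uf; apply: contrapT => no.
have : size (filter lin p) <= size [:: x; y].
  apply: uniq_leq_size => // z; rewrite mem_filter !inE => /andP[zl _].
  by apply: contrapT => /negP; rewrite negb_or => /andP[zx zy]; apply: no; exists z.
by rewrite size_filter leqNgt lin_gt2.
Qed.

Let cons_rem x w : lin x -> perm_eq p (x :: w) -> perm_eq (rem x p) w.
Proof.
move=> xl pw; rewrite -(perm_cons x); apply: perm_trans pw.
by rewrite perm_sym perm_to_rem ?lin_mem.
Qed.

Let rcons_rem x w : lin x -> perm_eq p (rcons w x) -> perm_eq (rem x p) w.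
Proof. by move=> xl; rewrite perm_sym perm_rcons perm_sym; apply: cons_rem. Qed.

Let front x w w' : lin x -> perm_eq p (x :: w) -> perm_eq p (x :: w') ->
  R (x :: w) (x :: w').
Proof.
move=> xl pw pw'.
have := collapsed_eq (collapsed_rem xl) (cons_rem xl pw) (cons_rem xl pw').
by move/(bc_ctx bR [:: x] [::]); rewrite !cats0.
Qed.

Let back x w w' : lin x -> perm_eq p (rcons w x) -> perm_eq p (rcons w' x) ->
  R (rcons w x) (rcons w' x).
Proof.
move=> xl pw pw'.
have := collapsed_eq (collapsed_rem xl) (rcons_rem xl pw) (rcons_rem xl pw').
by move/(bc_ctx bR [::] [:: x]); rewrite !cats1.
Qed.

(** Both words are related to one that begins with [x] and ends with [y]. *)
Let front_back_neq x y w w' : lin x -> lin y -> x != y ->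
  perm_eq p (x :: w) -> perm_eq p (rcons w' y) -> R (x :: w) (rcons w' y).
Proof.
move=> xl yl xy pw pw'.
have px : perm_eq p (x :: rcons (rem y (rem x p)) y).
  apply: (perm_trans (perm_to_rem (lin_mem xl))); rewrite perm_cons perm_sym perm_rcons.
  rewrite perm_sym perm_to_rem //; have := lin_mem yl.
  by rewrite (perm_mem (perm_to_rem (lin_mem xl))) inE eq_sym (negPf xy).
exact: (bc_trans bR (front xl pw px) (back (w := x :: _) yl px pw')).
Qed.

Let extremal s := exists x w, lin x /\ (s = x :: w \/ s = rcons w x).

(** A third linear letter placed at an end links any two such words by means of [front_back_neq];
    this is where more than two linear letters are required. *)
Let extremal_eq s t : extremal s -> extremal t -> perm_eq p s -> perm_eq p t -> R s t.
Proof.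
have ff x y w w' : lin x -> lin y -> perm_eq p (x :: w) -> perm_eq p (y :: w') ->
    R (x :: w) (y :: w').
  move=> xl yl px py; have [z [zl zx zy]] := third x y.
  have pz : perm_eq p (rcons (rem z p) z).
    by rewrite perm_sym perm_rcons perm_sym perm_to_rem ?lin_mem.
  apply: (bc_trans bR (front_back_neq xl zl _ px pz)); first by rewrite eq_sym.
  by apply/(bc_sym bR)/front_back_neq => //; rewrite eq_sym.
have fb x y w w' : lin x -> lin y -> perm_eq p (x :: w) -> perm_eq p (rcons w' y) ->
    R (x :: w) (rcons w' y).
  move=> xl yl px py; have [z [zl _ zy]] := third x y.
  have pz : perm_eq p (z :: rem z p) by rewrite perm_to_rem ?lin_mem.
  exact: (bc_trans bR (ff _ _ _ _ xl zl px pz) (front_back_neq zl yl zy pz py)).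
move=> [x [w [xl sE]]] [y [w' [yl tE]]] ps pt.
case: sE ps => ->; case: tE pt => -> pt ps.
- exact: ff.
- exact: fb.
- by apply: (bc_sym bR); apply: fb.
have [z [zl zx zy]] := third x y.
have pz : perm_eq p (z :: rem z p) by rewrite perm_to_rem ?lin_mem.
by apply: (bc_trans bR _ (fb _ _ _ _ zl yl pz pt)); apply: (bc_sym bR); apply: fb.
Qed.

Let sparse := [rel x y | ~~ (lin x && lin y)].

(** Every linear letter is directly followed by a nonlinear one; the extra summand is a nonlinear
    first letter, which follows nothing. *)
Let count_sparse x s : path sparse x s -> ~~ lin (last x s) ->
  count lin (x :: s) + ~~ lin x <= count (predC lin) (x :: s).
Proof.
elim: s x => [|y s IHs] x /=; first by case: (lin x).
move=> /andP[xy ys] l; have := IHs _ ys l; move: xy => /=.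
by case: (lin x); case: (lin y) => //=; lia.
Qed.

Let adjacent s : sorted sparse s \/
  exists w1 x y w2, [/\ lin x, lin y & s = w1 ++ [:: x, y & w2]].
Proof.
elim: s => [|x [|y s] IHs]; [by left|by left|].
have [xy|] := boolP (sparse x y); last first.
  by rewrite /= negbK => /andP[xl yl]; right; exists [::], x, y, s.
case: IHs => [ys|[w1 [x' [y' [w2 [xl yl ->]]]]]].
  by left; apply/andP.
by right; exists (x :: w1), x', y', w2.
Qed.

(* A linear letter at either end of a word can be cancelled, and two adjacent
   linear letters can be moved as a block. A word to which neither applies has
   more occurrences of nonlinear letters than of linear ones. *)
Lemma collapsed_add_linear : collapsed R p.
Proof.
have toE s : perm_eq p s -> exists s', [/\ extremal s', perm_eq p s' & R s s'].
  move=> ps.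
  case: (adjacent s) => [srt|[w1 [x [y [w2 [xl yl sE]]]]]]; last first.
    have pxy : perm_eq p [:: x, y & w1 ++ w2].
      apply: (perm_trans ps); rewrite sE.
      by rewrite -[[:: x, y & w2]]/([:: x; y] ++ w2) perm_catCA.
    exists [:: x, y & w1 ++ w2]; split=> //; first by exists x, (y :: w1 ++ w2); auto.
    have pyx : perm_eq (rem y p) (x :: w1 ++ w2).
      apply: cons_rem => //; apply: (perm_trans pxy).
      exact/permEl/(perm_catCA [:: x] [:: y]).
    have pyx' : perm_eq (rem y p) (w1 ++ x :: w2).
      by apply: (perm_trans pyx); rewrite -cat1s perm_catCA.
    (* Dropping [y] leaves a word on whose permutations [R] is total, so there [x] moves to the
       front. Substituting xy for [x] restores the block, and [w1], [w2] stay fixed because [x] is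
       linear. *)
    pose f i := if i == x then [:: x; y] else [:: i].
    have f0 i : f i != [::] by rewrite /f; case: (i == x).
    have := bc_subst bR f0 (collapsed_eq (collapsed_rem yl) pyx' pyx).
    have fw w : x \notin w -> subst f w = w.
      elim: w => //= i w IHw; rewrite inE negb_or eq_sym => /andP[ix xw].
      by rewrite /subst /= -/(subst f w) IHw // /f (negPf ix).
    have := xl; rewrite /lin (seq.permP pxy) /= eqxx count_cat => /eqP x1.
    have xw1 : x \notin w1 by rewrite -has_pred1 has_count /=; lia.
    have xw2 : x \notin w2 by rewrite -has_pred1 has_count /=; lia.
    rewrite subst_cat -[x :: w2]cat1s -[x :: w1 ++ w2]cat1s !subst_cat.
    rewrite !(fw w1) // !(fw w2) //.
    by rewrite /subst /= /f eqxx sE.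
  exists s; split=> //; last exact: (bc_refl bR).
  apply: contrapT => nE.
  case: s ps srt nE => [|x s] ps srt nE.
    by move: lin_gt2; rewrite (seq.permP ps).
  have xl : ~~ lin x by apply/negP => xl; apply: nE; exists x, s; auto.
  have ll : ~~ lin (last x s).
    by apply/negP => l; apply: nE; exists (last x s), (belast x s); rewrite lastI; auto.
  have lE : count lin (x :: s) = count lin p by rewrite (seq.permP ps).
  have := count_sparse srt ll; have := count_predC lin (x :: s).
  move: lin_half; rewrite xl lE (perm_size ps) addn1 -addnn.
  by move=> h1 h2 h3; move: h1; rewrite -h2 leq_add2l leqNgt h3.
move=> q pq.
have [p' [pE pp' Rp]] := toE p (perm_refl p).
have [q' [qE pq' Rq]] := toE q pq.
apply: (bc_trans bR Rp); apply: (bc_trans bR _ (bc_sym bR Rq)).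
exact: extremal_eq.
Qed.

End AddLinearLetter.

End Collapsed.

(** * Representatives of the sets of words given by partitions, and the bound s *)

Definition base_word (lam : seq nat) : seq nat :=
  flatten [seq nseq (nth 0 lam i) i | i <- iota 0 (size lam)].

Lemma count_base_word (P : pred nat) lam :
  count P (base_word lam) = \sum_(0 <= i < size lam | P i) nth 0 lam i.
Proof.
rewrite count_flatten -map_comp sumnE big_map big_mkcond /index_iota subn0 /=.
rewrite [RHS]big_mkcond; apply: eq_bigr => i _ /=.
by rewrite count_nseq; case: (P i); rewrite ?mul1n ?mul0n.
Qed.

Lemma count_mem_base_word lam i : count_mem i (base_word lam) = nth 0 lam i.
Proof.
rewrite count_base_word big_nat1_eq; case: ltnP => // le_i.
by rewrite nth_default.
Qed.

Lemma size_base_word lam : size (base_word lam) = sumn lam.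
Proof.
rewrite -count_predT count_base_word [in RHS](_ : lam = mkseq (nth 0 lam) (size lam)).
  by rewrite sumnE big_map /index_iota subn0.
by rewrite mkseq_nth.
Qed.

Lemma mem_base_word lam i : i \in base_word lam -> i < size lam.
Proof.
by case/flattenP=> _ /mapP[j + ->]; rewrite mem_iota add0n => /[swap] /nseqP[->].
Qed.

Lemma base_word_append_ones lam k :
  base_word (append_ones lam k) = base_word lam ++ iota (size lam) k.
Proof.
rewrite /base_word /append_ones size_cat size_nseq iotaD map_cat flatten_cat.
congr (_ ++ _).
  congr flatten; apply/eq_in_map => i; rewrite mem_iota add0n => /andP[_ lt_i].
  by rewrite nth_cat lt_i.
rewrite add0n -[RHS]flatten_seq1 /=; congr flatten.
apply/eq_in_map => i; rewrite mem_iota => /andP[le_i lt_i].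
by rewrite nth_cat ltnNge le_i /= nth_nseq ltn_subLR // lt_i.
Qed.

Lemma Wwords_base_word lam u : all (fun l => 0 < l) lam ->
  perm_eq (base_word lam) (letters u) -> Wwords lam u.
Proof.
move=> pos p; split=> i; last by rewrite -(seq.permP p) count_mem_base_word.
rewrite -(perm_mem p); apply/idP/idP => [/mem_base_word //|lt_i].
rewrite -has_pred1 has_count count_mem_base_word.
exact: (allP pos) (mem_nth 0 lt_i).
Qed.

Lemma base_word_Wwords lam u :
  Wwords lam u -> perm_eq (base_word lam) (letters u).
Proof.
move=> [mu cu]; apply/allP => i _; apply/eqP; rewrite /= -/(letters u).
rewrite -[LHS]/(count_mem i (base_word lam)) -[RHS]/(count_mem i (letters u)).
rewrite count_mem_base_word; have [lt_i|le_i] := ltnP i (size lam); first by rewrite cu.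
by rewrite nth_default //; apply/esym/count_memPn; rewrite mu -leqNgt.
Qed.

Lemma le_Wvar (V : OC) lam : lam != [::] -> all (fun l => 0 < l) lam ->
  (V <= Wvar lam)%O <-> collapsed (Id V) (base_word lam).
Proof.
move=> lam0 pos; split=> [/asboolP VW q pq S VS f|cV].
  have bw0 : base_word lam != [::].
    case: lam lam0 pos {VW pq} => // a lam _ /andP[a0 _].
    by rewrite -size_eq0 size_base_word /= -lt0n addn_gt0 a0.
  have q0 : q != [::] by rewrite -size_eq0 -(perm_size pq) size_eq0.
  rewrite !evs_mkword //; congr Some; apply: VW => //.
  by split; apply: Wwords_base_word; rewrite ?mkwordK.
apply/asboolP => S VS u v [uW vW]; apply/satisfiesP => f.
have bV := Id_bc V.
by apply: (collapsed_eq bV cV) => //; apply: base_word_Wwords.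
Qed.

Lemma append_ones_pos lam k :
  all (fun l => 0 < l) lam -> all (fun l => 0 < l) (append_ones lam k).
Proof. by move=> pos; rewrite all_cat pos; apply/allP => x /nseqP[->]. Qed.

Lemma append_ones_neq0 lam k : lam != [::] -> append_ones lam k != [::].
Proof. by case: lam. Qed.

Lemma LambdaP lam : Lambda lam ->
  [/\ 1 < size lam, lam != [::], all (fun l => 0 < l) lam & sorted geq lam].
Proof.
move=> [n [m /and5P[/andP[m2 _] /eqP sm _ pos srt]]].
by rewrite -size_eq0 sm; case: m m2 sm => // m.
Qed.

Lemma sumn_rq lam : all (fun l => 0 < l) lam -> sumn lam = r_ lam + q_ lam.
Proof.
rewrite /r_ /q_; elim: lam => [|a lam IH] /=; first by rewrite big_nil.
move=> /andP[a0 /IH ->]; rewrite big_cons; case: a a0 => [|[|a]] //= _; lia.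
Qed.

(* The two inequalities which make collapsed_add_linear apply to lam^(k+1). *)
Lemma s_bounds lam k : Lambda lam -> s_ lam <= k ->
  1 < q_ lam + k /\ r_ lam <= (q_ lam + k).+1.
Proof.
move=> /LambdaP[sz _ pos srt]; rewrite /s_ /delta_; case: eqP => [->|lam21].
  (* For (2,1) the value 0 of delta gives s = 1, so [q_ lam + k] is at least 2; with delta = 1 it
     could be 1. *)
  rewrite /r_ /q_ !big_cons big_nil /=; lia.
move=> le_k; have rk : r_ lam <= (q_ lam + k).+1 by lia.
(* Otherwise q + k is at most 1 and r at most 2. Two parts equal to 1 are then excluded, so the
   largest part is 2 and the remaining ones sum to at most 1, which leaves only (2,1). *)
split=> //; rewrite ltnNge; apply/negP => qk; apply: lam21.
case: lam sz pos srt rk qk {le_k} => [|a [|b lam]] // _ pos srt rk qk.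
have /= /and3P[a0 b0 posl] := pos; have /= /andP[ba _] := srt.
have rE : r_ [:: a, b & lam] = (if 1 < a then a else 0) + r_ (b :: lam).
  by rewrite /r_ big_cons; case: ifP.
have qE : q_ [:: a, b & lam] = (a == 1) + ((b == 1) + q_ lam) by [].
have qE' : q_ (b :: lam) = (b == 1) + q_ lam by [].
have sE : b + sumn lam = r_ (b :: lam) + q_ (b :: lam).
  by rewrite -sumn_rq //= b0.
rewrite {}rE {}qE in rk qk; rewrite {}qE' in sE.
have a1 : 1 < a.
  by rewrite ltnNge; apply/negP => a1; move: ba qk; rewrite /geq /=; lia.
rewrite a1 in rk.
have [-> bE] : a = 2 /\ b + sumn lam <= 1 by lia.
case: lam posl bE {pos srt rk qk sE} => [|c lam] /=.
  by move=> _; rewrite addn0; case: b b0 {ba} => [|[]].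
by move=> /andP[c0 _]; lia.
Qed.

Lemma count_linear_base_word lam : all (fun l => 0 < l) lam ->
  count (fun x => count_mem x (base_word lam) == 1) (base_word lam) = q_ lam.
Proof.
move=> pos; rewrite (eq_count (a2 := fun i => nth 0 lam i == 1)); last first.
  by move=> i /=; rewrite count_mem_base_word.
rewrite count_base_word (eq_bigr (fun=> 1)); last by move=> i /eqP.
rewrite /q_ -[in RHS](mkseq_nth 0 lam) count_map.
by rewrite sum1_count /index_iota subn0.
Qed.

Section CollapseSvar.

Variables (R : seq nat -> seq nat -> Prop) (bR : balanced_congruence R).
Variable lam : seq nat.

(** Deleting one linear letter or another gives the same word up to renaming and permutation. *)
Lemma collapsed_rem_linear p x y : collapsed R (rem y p) ->
  count_mem x p = 1 -> count_mem y p = 1 -> collapsed R (rem x p).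
Proof.
move=> cy x1 y1; have [<-//|yx] := eqVneq y x.
have xp : x \in p by rewrite -has_pred1 has_count x1.
have yp : y \in rem x p.
  have : y \in p by rewrite -has_pred1 has_count y1.
  by rewrite (perm_mem (perm_to_rem xp)) inE (negPf yx).
set r := rem y (rem x p).
have pxy : perm_eq p [:: x, y & r].
  by apply: (perm_trans (perm_to_rem xp)); rewrite perm_cons perm_to_rem.
have yr : y \notin r.
  move: y1; rewrite (seq.permP pxy) /= eqxx -has_pred1 has_count.
  by case: (x == y); case: count.
have ryE : perm_eq (rem y p) (x :: r).
  have := perm_to_rem (_ : y \in p); rewrite -has_pred1 has_count y1 => /(_ isT) py.
  rewrite -(perm_cons y); apply: (perm_trans (_ : perm_eq _ p)).
    by rewrite perm_sym.
  by apply: (perm_trans pxy); apply/permEl/(perm_catCA [:: x] [:: y]).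
pose g i := if i == x then y else i.
have xr : x \notin r.
  move: x1; rewrite (seq.permP pxy) /= eqxx -has_pred1 has_count.
  by case: (y == x); case: count.
have gE : map g (x :: r) = y :: r.
  rewrite /= /g eqxx; congr cons; rewrite -[RHS]map_id; apply/eq_in_map => i ir.
  by case: eqVneq => // E; rewrite -E ir in xr.
apply: (collapsed_perm bR (p := map g (x :: r))).
  exact/(collapsed_map bR)/(collapsed_perm bR cy ryE).
by rewrite gE perm_sym perm_to_rem.
Qed.

(** Beyond s the induction uses [collapsed_add_linear]: the next word has q + i + 1 linear letters
    and length r + q + i + 1, at most twice that number by [s_bounds]. *)
Lemma collapsed_append_ones : Lambda lam ->
  (forall i, i <= s_ lam -> collapsed R (base_word (append_ones lam i))) ->
  forall i, collapsed R (base_word (append_ones lam i)).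
Proof.
move=> lamL H; elim=> [|i IHi]; first exact: H.
have [/H//|lt_i] := leqP i.+1 (s_ lam).
have [q2 rq] := s_bounds lamL lt_i.
have [_ _ pos _] := LambdaP lamL.
set p := base_word _.
have qE : count (fun x => count_mem x p == 1) p = (q_ lam + i).+1.
  rewrite count_linear_base_word ?append_ones_pos // /q_ count_cat count_nseq /=.
  by rewrite mul1n addnS.
have pE : perm_eq p (size lam + i :: base_word (append_ones lam i)).
  rewrite /p !base_word_append_ones -addn1 iotaD catA.
  by rewrite perm_sym -cat1s perm_catC.
apply: (collapsed_add_linear bR) => [x x1||].
- have zp : size lam + i \in p by rewrite (perm_mem pE) mem_head.
  apply: (@collapsed_rem_linear _ _ (size lam + i)) (eqP x1) _.
    apply: (collapsed_perm bR IHi).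
    by rewrite -(perm_cons (size lam + i)) -(permPl pE) perm_to_rem.
  by rewrite count_mem_base_word nth_cat ltnNge leq_addr addKn nth_nseq ltnSn.
- by rewrite qE.
- rewrite qE /p size_base_word /append_ones sumn_cat sumn_nseq sumn_rq //; lia.
Qed.

End CollapseSvar.

(* Equivalently, p is the image, under a map of letters, of a word of
   W_(lam^k) for some k. *)
Definition contains (lam p : seq nat) : Prop :=
  exists g : nat -> nat,
    forall y, count_mem y (map g (base_word lam)) <= count_mem y p.

Lemma contains_perm lam p q : perm_eq p q -> contains lam p -> contains lam q.
Proof. by move=> pq [g H]; exists g => y; rewrite -(seq.permP pq). Qed.

Lemma contains_ctx lam a b p : contains lam p -> contains lam (a ++ p ++ b).
Proof.
move=> [g H]; exists g => y; apply: leq_trans (H y) _.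
by rewrite !count_cat addnCA leq_addr.
Qed.

Lemma contains_subst lam f p : (forall i, f i != [::]) ->
  contains lam p -> contains lam (subst f p).
Proof.
move=> f0 [g /count_mem_leP[r pr]]; pose h i := head 0 (f i).
exists (h \o g) => y; apply: (@leq_trans (count_mem y (map h p))).
  by rewrite (seq.permP (perm_map h pr)) map_cat count_cat map_comp leq_addr.
elim: p {pr} => //= i p IHp; rewrite /subst /= -/(subst f p) count_cat.
rewrite leq_add // /h; case: (f i) (f0 i) => //= x s _.
by rewrite leq_addr.
Qed.

Lemma collapsed_contains R lam p : balanced_congruence R ->
  (forall i, collapsed R (base_word (append_ones lam i))) ->
  contains lam p -> collapsed R p.
Proof.
move=> bR cR [g /count_mem_leP[r pr]].
(* Each occurrence left over in [r] becomes the image of one appended linear letter. *)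
pose h i := if i < size lam then g i else nth 0 r (i - size lam).
have hE : map h (base_word (append_ones lam (size r))) = map g (base_word lam) ++ r.
  rewrite base_word_append_ones map_cat; congr (_ ++ _).
    by apply/eq_in_map => i /mem_base_word; rewrite /h => ->.
  rewrite -[size lam]addn0 iotaDl -map_comp -[RHS](mkseq_nth 0).
  by apply/eq_map => i /=; rewrite /h ltnNge leq_addr addKn.
have cp := collapsed_map bR (g := h) (cR (size r)).
by apply: (collapsed_perm bR cp); rewrite hE perm_sym.
Qed.

Lemma le_Svar (V : OC) lam : Lambda lam ->
  (V <= Svar lam)%O <-> forall i, collapsed (Id V) (base_word (append_ones lam i)).
Proof.
move=> lamL; have [_ lam0 pos _] := LambdaP lamL.
have WE i : (V <= Wvar (append_ones lam i))%O <->
    collapsed (Id V) (base_word (append_ones lam i)).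
  by apply: le_Wvar; rewrite ?append_ones_neq0 ?append_ones_pos.
split=> [VS|cV]; last by apply/meetsP => i _; apply/WE.
apply: collapsed_append_ones => // [|i le_is]; first exact: Id_bc.
by apply/WE; move/meetsP: VS => /(_ (Ordinal (n := (s_ lam).+1) (m := i) le_is) isT).
Qed.

Lemma Svar_contains lam p : Lambda lam -> contains lam p -> collapsed (Id (Svar lam)) p.
Proof.
by move=> lamL; apply: collapsed_contains; [apply: Id_bc|apply/le_Svar].
Qed.

(** An explicit form of the identities of the meet of the S_lambda, from which the zero-one property
    is immediate. *)
Definition contains_rel (lams : seq (seq nat)) (s t : seq nat) : Prop :=
  s = t \/ perm_eq s t /\ exists2 lam, lam \in lams & contains lam s.

Lemma contains_rel_bc lams : balanced_congruence (contains_rel lams).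
Proof.
split.
- by left.
- move=> s t [->|[st [lam inl cs]]]; [by left|right]; rewrite perm_sym; split=> //.
  by exists lam => //; apply: contains_perm cs.
- move=> s t u [->//|[st cs]] tu; right; split; last by [].
  by case: tu => [<-//|[tu _]]; apply: perm_trans tu.
- by move=> s t [->|[]].
- move=> a b s t [->|[st [lam inl cs]]]; [by left|right].
  rewrite perm_cat2l perm_cat2r; split=> //.
  by exists lam => //; apply: contains_ctx.
- move=> f s t f0 [->|[st [lam inl cs]]]; [by left|right].
  split; first exact/perm_flatten/perm_map.
  by exists lam => //; apply: contains_subst.
Qed.

Lemma meets_Svar_zero_one lams : (forall lam, lam \in lams -> Lambda lam) ->
  zero_one (Id (\meet_(lam <- lams) Svar lam)%O).
Proof.
move=> lamsL; set V := (\meet_(lam <- lams) Svar lam)%O.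
have bR := contains_rel_bc lams.
suff -> : V = OC_of bR.
  move=> s t u /Id_OC_of[//|[st cs]] _ su; apply/Id_OC_of.
  by right.
apply/le_anti/andP; split; last first.
  apply/meetsP_seq => lam inl _; apply/le_Svar; first exact: lamsL.
  move=> i q pq; apply/Id_OC_of; right; split=> //.
  exists lam => //; exists id => y; rewrite map_id base_word_append_ones count_cat.
  exact: leq_addr.
apply/OC_le_Id => s t /Id_OC_of[->|[st [lam inl cs]]]; first exact: (bc_refl (Id_bc V)).
have VS : (V <= Svar lam)%O by apply: meets_inf_seq.
by move/OC_le_Id: VS; apply; apply: Svar_contains => //; apply: lamsL.
Qed.

Lemma eq_bc : balanced_congruence (@eq (seq nat)).
Proof. by split; intros; subst. Qed.

Lemma Id_SEM s t : Id SEM s t -> s = t.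
Proof.
have /OC_le_Id H : (OC_of eq_bc <= SEM)%O by apply/asboolP.
by move/H/Id_OC_of.
Qed.

(** * Finite bases *)

(** Induction on the number of coordinates. A basis for the first [k] of them covers every element
    whose last coordinate is at least [m], and each of the finitely many smaller values gets a basis
    of its own. *)
Lemma dickson (T : eqType) (f : nat -> T -> nat) k (P : T -> Prop) :
  exists2 l : seq T, (forall y, y \in l -> P y) &
    forall x, P x -> exists2 y, y \in l & forall j, j < k -> f j y <= f j x.
Proof.
elim: k P => [|k IHk] P.
  have [[x Px]|no] := pselect (exists x, P x); last first.
    by exists [::] => // x Px; case: no; exists x.
  exists [:: x] => [y|y _]; first by rewrite inE => /eqP ->.
  by exists x; rewrite ?mem_head.
have [l lP ldom] := IHk P.
have [m lm] : exists m, forall y, y \in l -> f k y <= m.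
  exists (\max_(y <- l) f k y) => y yl.
  exact: leq_bigmax_seq.
have [l' l'P l'dom] : exists2 l' : seq T, (forall y, y \in l' -> P y) &
    forall x, P x -> f k x < m ->
      exists2 y, y \in l' & forall j, j < k.+1 -> f j y <= f j x.
  elim: {lm} m => [|m [l' l'P l'dom]]; first by exists [::].
  have [l2 l2P l2dom] := IHk (fun x => P x /\ f k x = m).
  exists (l' ++ l2) => [y|x Px]; first by rewrite mem_cat => /orP[/l'P|/l2P[]].
  rewrite ltnS leq_eqVlt => /orP[/eqP fx|fx]; last first.
    by have [y yl' yx] := l'dom x Px fx; exists y; rewrite ?mem_cat ?yl'.
  have [y yl2 yx] := l2dom x (conj Px fx); exists y; rewrite ?mem_cat ?yl2 ?orbT //.
  move=> j; rewrite ltnS leq_eqVlt => /orP[/eqP ->|]; last exact: yx.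
  by have [_ ->] := l2P _ yl2; rewrite fx.
exists (l ++ l') => [y|x Px]; first by rewrite mem_cat => /orP[/lP|/l'P].
have [fx|fx] := ltnP (f k x) m.
  by have [y yl' yx] := l'dom x Px fx; exists y; rewrite ?mem_cat ?yl' ?orbT.
have [y yl yx] := ldom x Px; exists y; rewrite ?mem_cat ?yl //.
move=> j; rewrite ltnS leq_eqVlt => /orP[/eqP ->|]; last exact: yx.
by apply: leq_trans fx; apply: lm.
Qed.

Definition letters_by_count (p : seq nat) : seq nat :=
  sort (fun x y => count_mem y p <= count_mem x p) (undup p).

Definition word_type (p : seq nat) : seq nat :=
  map (fun x => count_mem x p) (letters_by_count p).

Lemma mem_letters_by_count p x : (x \in letters_by_count p) = (x \in p).
Proof. by rewrite mem_sort mem_undup. Qed.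

Lemma letters_by_count_uniq p : uniq (letters_by_count p).
Proof. by rewrite sort_uniq undup_uniq. Qed.

Lemma base_word_count (L p : seq nat) :
  map (nth 0 L) (base_word (map (fun x => count_mem x p) L)) =
  flatten [seq nseq (count_mem x p) x | x <- L].
Proof.
rewrite /base_word map_flatten -map_comp size_map.
rewrite -[in RHS](mkseq_nth 0 L) -[in RHS]map_comp.
congr flatten; apply/eq_in_map => i; rewrite mem_iota add0n => /andP[_ lt_i] /=.
by rewrite map_nseq (nth_map 0).
Qed.

Lemma base_word_type p :
  perm_eq (base_word (word_type p)) (map (index^~ (letters_by_count p)) p).
Proof.
set L := letters_by_count p.
have <- : map (index^~ L) (map (nth 0 L) (base_word (word_type p))) =
    base_word (word_type p).
  rewrite -map_comp -[RHS]map_id; apply/eq_in_map => i /mem_base_word.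
  rewrite size_map => lt_i; rewrite /= index_uniq //.
  exact: letters_by_count_uniq.
apply: perm_map; rewrite base_word_count.
apply: perm_trans (perm_count_undup p); apply/perm_flatten/perm_map.
by rewrite perm_sort.
Qed.

Lemma word_type_Lambda p : 1 < size (undup p) -> Lambda (word_type p).
Proof.
move=> p2; exists (sumn (word_type p)), (size (word_type p)).
have pos : all (fun l => 0 < l) (word_type p).
  apply/allP => _ /mapP[x xL ->].
  by rewrite -has_count has_pred1 -mem_letters_by_count.
have szE : size (word_type p) = size (undup p) by rewrite size_map size_sort.
rewrite /Lambda_nm /= !eqxx pos szE p2 -szE /=; apply/andP; split.
  elim: (word_type p) pos => //= a l IHl /andP[a0 /IHl]; lia.
rewrite /word_type /letters_by_count sorted_map; apply: sort_sorted => x y.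
exact: leq_total.
Qed.

(** The parts of the type of [b] form a submultiset of the multiplicities in [p], so its letters can
    be sent to distinct letters of [p] with the same multiplicities. *)
Lemma contains_word_type p b :
  (forall j, count_mem j (word_type b) <= count_mem j (word_type p)) ->
  contains (word_type b) p.
Proof.
move=> /count_subseqP[s /subseqP[m _ ->]]; rewrite -map_mask perm_sym.
case/perm_map_lift=> L pL EL; rewrite EL; exists (nth 0 L) => y.
rewrite base_word_count.
have uL : uniq L by rewrite -(perm_uniq pL) mask_uniq ?letters_by_count_uniq.
elim: L uL {pL EL} => //= x L IHL /andP[xL uL]; rewrite count_cat count_nseq /=.
have [<-|xy] := eqVneq x y; last by rewrite mul0n; apply: IHL.
rewrite mul1n -[leqRHS]addn0 leq_add2l leqn0 -leqn0 leqNgt -has_count has_pred1.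
apply/negP => /flattenP[_ /mapP[z zL ->] /nseqP[xz _]].
by rewrite xz zL in xL.
Qed.

Lemma contains_letter lam p a :
  sumn lam <= count_mem a p -> contains lam p.
Proof.
move=> le_a; exists (fun=> a) => y; rewrite count_map.
have [<-|ay] := eqVneq a y; last first.
  by rewrite (eq_count (a2 := pred0)) ?count_pred0 // => i /=; apply: negPf.
by apply: leq_trans le_a; rewrite -size_base_word count_size.
Qed.

Lemma zero_one_finite_basis (V : OC) : zero_one (Id V) ->
  V = SEM \/ exists lams : seq (seq nat),
    lams <> [::] /\ (forall lam : seq nat, lam \in lams -> Lambda lam) /\
    V = (\meet_(lam <- lams) Svar lam)%O.
Proof.
move=> V01; have bV := Id_bc V.
pose nontriv p := exists2 q, Id V p q & p <> q.
have [[p0 p0n]|no] := pselect (exists p, nontriv p); last first.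
  left; apply: OC_eq_Id => s t; split=> [st|/Id_SEM ->]; last exact: (bc_refl bV).
  have [->|s_t] := pselect (s = t); first exact: (bc_refl (Id_bc SEM)).
  by case: no; exists s, t.
right.
have nontrivL p : nontriv p -> Lambda (word_type p).
  move=> [q /(bc_perm bV) pq p_q]; apply: word_type_Lambda.
  have [x xp _] := perm_neq_letter pq p_q 0.
  have [y yp yx] := perm_neq_letter pq p_q x.
  apply: (@uniq_leq_size _ [:: x; y]); first by rewrite /= inE eq_sym yx.
  by move=> z; rewrite !inE mem_undup => /orP[]/eqP->.
have nontriv_collapsed p i : nontriv p ->
    collapsed (Id V) (base_word (append_ones (word_type p) i)).
  move=> [q pq p_q]; set g := index^~ (letters_by_count p).
  set ones := iota (size (word_type p)) i.
  (* [g] is injective on the letters of [p], so this identity is still nontrivial and the zero-one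
     property makes [Id V] total here. *)
  have Ipq : Id V (map g p ++ ones) (map g q ++ ones).
    by apply: (bc_cat bV (bc_map g bV pq)); apply: (bc_refl bV).
  apply: (collapsed_perm bV (p := map g p ++ ones)); last first.
    by rewrite base_word_append_ones perm_cat2r perm_sym base_word_type.
  move=> r; apply: V01 Ipq _ => /eqP.
  rewrite eqseq_cat ?size_map ?(perm_size (bc_perm bV pq)) // eqxx andbT => /eqP gE; apply: p_q.
  have gK s : perm_eq p s -> map (nth 0 (letters_by_count p)) (map g s) = s.
    move=> ps; rewrite -map_comp -[RHS]map_id; apply/eq_in_map => x xs.
    by rewrite /= nth_index // mem_letters_by_count (perm_mem ps).
  by rewrite -[LHS]gK // gE gK // (bc_perm bV pq).
(* A word in which some letter occurs at least [n] times contains the type of [p0], all of whose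
   letters can be sent to that one. In the other words all multiplicities are below [n], so [n]
   numbers describe their type and Dickson's lemma applies. *)
pose n := sumn (word_type p0).
have [l lP ldom] := dickson (fun j p => count_mem j (word_type p)) n
  (fun p => nontriv p /\ all (fun a => count_mem a p < n) p).
exists (map word_type (p0 :: l)); split=> //; split.
  move=> lam /mapP[p + ->]; rewrite inE => /orP[/eqP->|/lP[pn _]]; exact: nontrivL.
have nl p : p \in p0 :: l -> nontriv p.
  by rewrite inE => /orP[/eqP->|/lP[]].
apply/le_anti/andP; split.
  apply/meetsP_seq => _ /mapP[p pl ->] _; apply/le_Svar; first exact/nontrivL/nl.
  by move=> i; apply/nontriv_collapsed/nl.
apply/OC_le_Id => s t st.
have [<-|s_t] := pselect (s = t); first exact: (bc_refl (Id_bc _)).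
have sn : nontriv s by exists t.
have [p pl ps] : exists2 p, p \in p0 :: l & contains (word_type p) s.
  have [small|/allPn[a as_ la]] := boolP (all (fun a => count_mem a s < n) s); last first.
    exists p0; first exact: mem_head.
    by apply: (@contains_letter _ _ a); rewrite leqNgt.
  have [p pl dom] := ldom s (conj sn small); exists p; first by rewrite inE pl orbT.
  apply: contains_word_type => j; have [/dom //|le_nj] := ltnP j n.
  rewrite (count_memPn _) //; apply/negP => /mapP[x].
  rewrite mem_letters_by_count => xp jE.
  have [_ /allP/(_ _ xp)] := lP _ pl.
  by rewrite -jE ltnNge le_nj.
have VS : (\meet_(lam <- map word_type (p0 :: l)) Svar lam <= Svar (word_type p))%O.
  by apply: meets_inf_seq => //; apply: map_f.
move/OC_le_Id: VS; apply; apply: Svar_contains ps _ (bc_perm bV st).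
exact/nontrivL/nl.
Qed.

Theorem theorem2p2 (V : OC) :
  [<-> distributive_element V;
       codistributive_element V;
       standard_element V;
       costandard_element V;
       neutral_element V;
       V = SEM \/
       exists lams : seq (seq nat),
         lams <> [::] /\
         (forall lam : seq nat, lam \in lams -> Lambda lam) /\
         V = (\meet_(lam <- lams) Svar lam)%O].
Proof.
have zo : distributive_element V \/ codistributive_element V -> zero_one (Id V).
  move=> sp; apply: distributive_zero_one; first exact: Id_bc.
  by case: sp => [/distributive_Id|/codistributive_Id]; [left|right].
have neu_dis : neutral_element V -> distributive_element V.
  by move=> /neutral_standard /standard_distributive.
tfae.
- move=> dis; apply/costandard_codistributive/neutral_costandard.
  by apply/zero_one_neutral/zo; left.
- by move=> codis; apply/neutral_standard/zero_one_neutral/zo; right.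
- move=> /standard_distributive dis.
  by apply/neutral_costandard/zero_one_neutral/zo; left.
- move=> /costandard_codistributive codis.
  by apply/zero_one_neutral/zo; right.
- by move=> /neu_dis dis; apply/zero_one_finite_basis/zo; left.
- move=> V6; apply/neu_dis/zero_one_neutral.
  case: V6 => [->|[lams [_ [lamsL ->]]]]; last exact: meets_Svar_zero_one.
  by move=> s t u /Id_SEM.
Qed.
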